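(* Let $F:\mathbb{C}\to\mathbb{C}$ be an entire function, $F\not\equiv 0$, let $a\in\mathbb{C}$ be a node or focus of $\dot{x}=F(x)$, and let $\mathcal{N}$ be the basin of $F$ in $a$. Then $\partial\mathcal{N}$ is either empty or consists only of equilibria and unbounded orbits, and $\mathcal{N}$ is unbounded.
   Context: Consider the autonomous planar system $\dot{x}=F(x)$, $x\in\mathbb{C}$, $t\in\mathbb{R}$, with flow $\Phi(t,x)$ on the maximal interval of existence; $\Gamma(x)$ is the (full) orbit through $x$. $w_+(\Gamma)$ (resp. $w_-(\Gamma)$) is the positive (resp. negative) limit set of an orbit $\Gamma$, i.e. the set of all limits in $\mathbb{C}$ along sequences of times tending to the right (resp. left) endpoint of the maximal interval of existence. Equilibria are the zeros of $F$. A node or focus is a simple zero $a$ of $F$ that is attracting (stable) or repelling (unstable), i.e. all orbits through some neighborhood of $a$ tend to $a$ in positive time (attracting) or in negative time (repelling). The basin of $a$ is $\mathcal{N}=\{x\in\mathbb{C}: w_{+}(\Gamma(x))=\{a\}\}$ if $a$ is attracting, and $\mathcal{N}=\{x\in\mathbb{C}: w_{-}(\Gamma(x))=\{a\}\}$ if $a$ is repelling. $\partial\mathcal{N}$ is the topological boundary in $\mathbb{C}$. An orbit is unbounded if it is an unbounded subset of $\mathbb{C}$. *)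

(* Defs.v *)
From Stdlib Require Export Reals.
From Coquelicot Require Export Coquelicot.
Open Scope R_scope.

Definition entire (F : C -> C) : Prop :=
  forall z : C, ex_derive (K := C_AbsRing) (V := C_NormedModule) F z.

Definition between (al be : Rbar) (t : R) : Prop :=
  Rbar_lt al t /\ Rbar_lt t be.

Definition solution (F : C -> C) (al be : Rbar) (phi : R -> C) : Prop :=
  forall t : R, between al be t ->
    is_derive (K := R_AbsRing) (V := C_R_NormedModule) phi t (F (phi t)).

(* [phi] is the trajectory t |-> Phi(t,x), and (al, be) is its maximal interval
   of existence; the values of [phi] outside (al, be) are irrelevant. *)
Definition maximal_solution
    (F : C -> C) (x : C) (al be : Rbar) (phi : R -> C) : Prop :=
  between al be 0 /\ phi 0 = x /\ solution F al be phi /\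
  forall (al' be' : Rbar) (psi : R -> C),
    Rbar_le al' al -> Rbar_le be be' ->
    solution F al' be' psi ->
    (forall t : R, between al be t -> psi t = phi t) ->
    al' = al /\ be' = be.

Definition orbit (F : C -> C) (x y : C) : Prop :=
  exists (al be : Rbar) (phi : R -> C),
    maximal_solution F x al be phi /\
    exists t : R, between al be t /\ phi t = y.

Definition limit_point_at
    (al be e : Rbar) (phi : R -> C) (y : C) : Prop :=
  exists u : nat -> R,
    (forall n : nat, between al be (u n)) /\
    is_lim_seq u e /\
    filterlim (fun n => phi (u n)) eventually (locally (T := C_UniformSpace) y).

Definition w_plus (F : C -> C) (x y : C) : Prop :=
  exists (al be : Rbar) (phi : R -> C),
    maximal_solution F x al be phi /\ limit_point_at al be be phi y.

Definition w_minus (F : C -> C) (x y : C) : Prop :=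
  exists (al be : Rbar) (phi : R -> C),
    maximal_solution F x al be phi /\ limit_point_at al be al phi y.

Definition tends_to_forward (F : C -> C) (x a : C) : Prop :=
  exists (al be : Rbar) (phi : R -> C),
    maximal_solution F x al be phi /\
    filterlim phi (within (between al be) (Rbar_locally be))
      (locally (T := C_UniformSpace) a).

Definition tends_to_backward (F : C -> C) (x a : C) : Prop :=
  exists (al be : Rbar) (phi : R -> C),
    maximal_solution F x al be phi /\
    filterlim phi (within (between al be) (Rbar_locally al))
      (locally (T := C_UniformSpace) a).

Definition attracting (F : C -> C) (a : C) : Prop :=
  locally (T := C_UniformSpace) a (fun x => tends_to_forward F x a).

Definition repelling (F : C -> C) (a : C) : Prop :=
  locally (T := C_UniformSpace) a (fun x => tends_to_backward F x a).

Definition simple_zero (F : C -> C) (a : C) : Prop :=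
  F a = RtoC 0 /\ C_derive F a <> RtoC 0.

Definition node_or_focus (F : C -> C) (a : C) : Prop :=
  simple_zero F a /\ (attracting F a \/ repelling F a).

Definition basin (F : C -> C) (a x : C) : Prop :=
  (attracting F a /\ forall y : C, w_plus F x y <-> y = a) \/
  (repelling F a /\ forall y : C, w_minus F x y <-> y = a).

Definition boundary (S : C -> Prop) (z : C) : Prop :=
  forall U : C -> Prop, open (T := C_UniformSpace) U -> U z ->
    (exists y : C, U y /\ S y) /\ (exists y : C, U y /\ ~ S y).

Definition equilibrium (F : C -> C) (z : C) : Prop := F z = RtoC 0.

Definition unbounded (S : C -> Prop) : Prop :=
  ~ exists M : R, forall z : C, S z -> Cmod z <= M.

(* Main.v *)
Require Import Defs.
From Stdlib Require Import Lra Lia Classical ClassicalEpsilon.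

(** Why the theorem holds.  The flow of an entire vector field [F] extends to complex time: the
equation [w' = F(w)] can be solved with a complex independent variable, on a disk whose radius is
uniform over bounded sets of initial values ([local_flow]).  Complex-time motion commutes with
real-time motion ([flow_commutes]).  Hence, if [gam] is a bounded solution, then for each small
complex [s] the curve obtained by moving every point [gam t] by the complex time [s] is again a
solution, and it stays uniformly close to [gam]; if [gam 0] is not an equilibrium, these curves
pass through all points near [gam 0], because complex time is then a local coordinate
([cflow_cover]).  So every bounded solution through a regular point is stable, uniformly over its
whole interval of existence ([bounded_stability]).

Suppose [a] attracts.  The set of points whose orbit tends to [a] is open and invariant.  If a
regular point [z] in its closure had a bounded orbit, stability would keep that orbit close to
orbits tending to [a]; it would enter the attracted neighbourhood of [a], so [z] would be an
interior point ([converges_of_bounded_orbit]).  A boundary point is therefore an equilibrium or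
has an unbounded orbit, and continuous dependence on initial values, again a case of
[bounded_stability], makes the boundary invariant.

If the attracted set were bounded, complex time steps of a fixed size would map it into itself, so
the complex solution starting at one of its points would extend to disks of any radius while
staying bounded ([cflow_extend]); by Liouville's argument it would be constant.  But the attracted
set contains points near [a] that are not equilibria ([converges_unbounded]).

A repelling [a] is an attracting point of the reversed field.  The basin is the union of the two
attracted sets for [F] and [- F], restricted to the cases in which [a] attracts or repels
([basin_iff]), and each argument above applies to either part of this union.

The complex analysis behind this is Goursat's lemma, which gives primitives on disks and half
planes ([primitive_exists]).  Cauchy's estimate follows from primitives alone
([cauchy_estimate]); it makes [F] locally Lipschitz and yields Liouville's argument. *)

(** * Calculus of maps into the complex plane *)

Lemma Cmod_minus_sym (x y : C) : Cmod (x - y) = Cmod (y - x).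
Proof. rewrite <- Cmod_opp. f_equal. ring. Qed.

Lemma Cmod_tri3 (x y z : C) : Cmod (x - z) <= Cmod (x - y) + Cmod (y - z).
Proof. replace (x - z)%C with ((x - y) + (y - z))%C by ring. apply Cmod_triangle. Qed.

Lemma Cmod_minus_le (x y : C) : Cmod (x - y) <= Cmod x + Cmod y.
Proof. unfold Cminus. rewrite <- (Cmod_opp y). apply Cmod_triangle. Qed.

Lemma Cmod_le_minus (x y : C) : Cmod x <= Cmod y + Cmod (x - y).
Proof. replace x with (y + (x - y))%C at 1 by ring. apply Cmod_triangle. Qed.

Lemma Cmod_minus_0 (x y : C) : Cmod (x - y) <= 0 -> x = y.
Proof.
  intros H. apply Ceq_minus, Cmod_eq_0. pose proof (Cmod_ge_0 (x - y)). lra.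
Qed.

Lemma Cmod_minus_diag (x : C) : Cmod (x - x) = 0.
Proof. replace (x - x)%C with (RtoC 0) by ring. apply Cmod_0. Qed.

Lemma im_le_Cmod (z : C) : Rabs (Im z) <= Cmod z.
Proof. eapply Rle_trans; [apply Rmax_r | apply Rmax_Cmod]. Qed.

Lemma Cmod_le_sum (z : C) : Cmod z <= Rabs (Re z) + Rabs (Im z).
Proof.
  unfold Re, Im. replace z with (RtoC (fst z) + Ci * RtoC (snd z))%C at 1.
  - eapply Rle_trans; [apply Cmod_triangle|].
    rewrite Cmod_mult, Cmod_Ci, !Cmod_R. lra.
  - destruct z as [x y]. unfold RtoC, Ci, Cplus, Cmult; simpl. f_equal; ring.
Qed.

Lemma pow2_small (K e : R) : 0 <= K -> 0 < e -> exists n, K / 2 ^ n < e.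
Proof.
  intros HK He.
  destruct (pow_lt_1_zero (/2) ltac:(rewrite Rabs_pos_eq; lra) (e / (K + 1)))
    as [N HN]; [apply Rdiv_lt_0_compat; lra|].
  exists N. specialize (HN N (le_n _)). rewrite Rabs_pos_eq in HN by (apply pow_le; lra).
  rewrite pow_inv in HN. unfold Rdiv. apply Rle_lt_trans with ((K + 1) * / 2 ^ N).
  - apply Rmult_le_compat_r; [left; apply Rinv_0_lt_compat, pow_lt; lra | lra].
  - apply (Rmult_lt_compat_l (K + 1)) in HN; [|lra].
    replace ((K + 1) * (e / (K + 1))) with e in HN by (field; lra). exact HN.
Qed.

(** Completeness, in the form used for nested triangles and for Picard iterates. *)
Lemma geometric_limit (u : nat -> C) (K : R) :
  (forall n, Cmod (u (S n) - u n) <= K / 2 ^ n) ->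
  exists l, forall n, Cmod (u n - l) <= 2 * K / 2 ^ n.
Proof.
  intros H.
  assert (K0 : 0 <= K).
  { specialize (H O). simpl in H. pose proof (Cmod_ge_0 (u 1%nat - u 0%nat)). lra. }
  assert (P2 : forall n, 0 < 2 ^ n) by (intros; apply pow_lt; lra).
  assert (Hk : forall n k, Cmod (u (n + k)%nat - u n) <= 2 * K / 2 ^ n).
  { intros n k.
    assert (Cmod (u (n + k)%nat - u n) <= 2 * K / 2 ^ n * (1 - / 2 ^ k)).
    { induction k as [|k IH].
      - rewrite Nat.add_0_r, Cmod_minus_diag. simpl. lra.
      - rewrite Nat.add_succ_r. eapply Rle_trans; [apply (Cmod_tri3 _ (u (n + k)%nat))|].
        eapply Rle_trans; [apply Rplus_le_compat; [apply H | apply IH]|].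
        rewrite pow_add. simpl. right. field. split; apply Rgt_not_eq, P2. }
    eapply Rle_trans; [apply H0|]. rewrite <- (Rmult_1_r (2 * K / 2 ^ n)) at 2.
    apply Rmult_le_compat_l.
    - apply Rmult_le_pos; [lra|]. left. apply Rinv_0_lt_compat, P2.
    - pose proof (Rinv_0_lt_compat _ (P2 k)). lra. }
  assert (Cc : forall f : C -> R, (forall z, Rabs (f z) <= Cmod z) ->
     (forall x y, f (x - y)%C = f x - f y) -> exists l, Un_cv (fun n => f (u n)) l).
  { intros f Hf Hm. destruct (Rcomplete.R_complete (fun n => f (u n))) as [l Hl].
    - intros e He. destruct (pow2_small (2 * K) (e / 2)) as [N HN]; [lra|lra|]. exists N. intros n m Hn Hm'.
      unfold Rdist. rewrite <- Hm. eapply Rle_lt_trans; [apply Hf|].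
      eapply Rle_lt_trans; [apply (Cmod_tri3 _ (u N))|].
      rewrite (Cmod_minus_sym (u N)).
      replace n with (N + (n - N))%nat by lia. replace m with (N + (m - N))%nat by lia.
      pose proof (Hk N (n - N)%nat). pose proof (Hk N (m - N)%nat). lra.
    - exists l. exact Hl. }
  destruct (Cc Re re_le_Cmod (fun _ _ => eq_refl)) as [a Ha].
  destruct (Cc Im im_le_Cmod (fun _ _ => eq_refl)) as [b Hb].
  exists (a, b). intros n. apply le_epsilon. intros e He.
  destruct (Ha (e / 2)) as [N1 H1]; [lra|]. destruct (Hb (e / 2)) as [N2 H2]; [lra|].
  set (k := (N1 + N2)%nat). eapply Rle_trans; [apply (Cmod_tri3 _ (u (n + k)%nat))|].
  apply Rplus_le_compat; [rewrite Cmod_minus_sym; apply Hk|].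
  eapply Rle_trans; [apply Cmod_le_sum|].
  assert (Q1 : (n + k >= N1)%nat) by lia. assert (Q2 : (n + k >= N2)%nat) by lia.
  specialize (H1 _ Q1). specialize (H2 _ Q2).
  change (Rabs (Re (u (n + k)%nat) - a) + Rabs (Im (u (n + k)%nat) - b) <= e).
  unfold Rdist in H1, H2. lra.
Qed.

(** One definition serves complex derivatives ([i] the identity) and velocities of curves ([i] the
inclusion of the reals), so that the rules of calculus are proved once for both. *)
Definition der {T : Type} (i f : T -> C) (x : T) (l : C) : Prop :=
  forall e, 0 < e -> exists d, 0 < d /\ forall y, Cmod (i y - i x) < d ->
    Cmod (f y - f x - l * (i y - i x)) <= e * Cmod (i y - i x).

Definition cont {T : Type} (i f : T -> C) (x : T) : Prop :=
  forall e, 0 < e -> exists d, 0 < d /\ forall y, Cmod (i y - i x) < d ->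
    Cmod (f y - f x) < e.

Notation cder := (der (fun z : C => z)).
Notation rder := (der RtoC).
Notation ccont := (cont (fun z : C => z)).
Notation rcont := (cont RtoC).

Section Rules.

Context {T : Type} (i : T -> C).
Implicit Types (f g : T -> C) (x : T).

Lemma der_cont f x l : der i f x l -> cont i f x.
Proof.
  intros H e He. destruct (H 1 ltac:(lra)) as [d [Hd H1]].
  pose proof (Cmod_ge_0 l) as Hl.
  exists (Rmin d (e / (2 + Cmod l))). split.
  - apply Rmin_glb_lt; [lra|]. apply Rdiv_lt_0_compat; lra.
  - intros w Hw. apply Rmin_Rgt_l in Hw as [A B].
    specialize (H1 w A). pose proof (Cmod_ge_0 (i w - i x)).
    eapply Rle_lt_trans; [apply (Cmod_le_minus _ (l * (i w - i x))%C)|]. rewrite Cmod_mult.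
    apply Rmult_gt_compat_l with (r := 2 + Cmod l) in B; [|lra].
    replace ((2 + Cmod l) * (e / (2 + Cmod l))) with e in B by (field; lra). nra.
Qed.

Lemma der_ext_loc f g z l r : 0 < r -> (forall w, Cmod (i w - i z) < r -> f w = g w) ->
  der i f z l -> der i g z l.
Proof.
  intros Hr Hfg H e He. destruct (H e He) as [d [Hd H1]].
  exists (Rmin d r). split; [apply Rmin_glb_lt; lra|].
  intros w Hw. apply Rmin_Rgt_l in Hw as [A B].
  rewrite <- !Hfg; auto. rewrite Cmod_minus_diag. lra.
Qed.

Lemma der_const c z : der i (fun _ => c) z (RtoC 0).
Proof.
  intros e He. exists 1. split; [lra|]. intros w _.
  replace (c - c - RtoC 0 * (i w - i z))%C with (RtoC 0) by ring. rewrite Cmod_0.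
  pose proof (Cmod_ge_0 (i w - i z)). nra.
Qed.

Lemma der_id x : der i i x (RtoC 1).
Proof.
  intros e He. exists 1. split; [lra|]. intros w _.
  replace (i w - i x - RtoC 1 * (i w - i x))%C with (RtoC 0) by ring. rewrite Cmod_0.
  pose proof (Cmod_ge_0 (i w - i x)). nra.
Qed.

Lemma der_plus f g z l m : der i f z l -> der i g z m ->
  der i (fun w => f w + g w)%C z (l + m)%C.
Proof.
  intros Hf Hg e He. destruct (Hf (e / 2) ltac:(lra)) as [d1 [Hd1 H1]].
  destruct (Hg (e / 2) ltac:(lra)) as [d2 [Hd2 H2]].
  exists (Rmin d1 d2). split; [apply Rmin_glb_lt; lra|].
  intros w Hw. apply Rmin_Rgt_l in Hw as [A B]. specialize (H1 w A). specialize (H2 w B).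
  replace (f w + g w - (f z + g z) - (l + m) * (i w - i z))%C with
    ((f w - f z - l * (i w - i z)) + (g w - g z - m * (i w - i z)))%C by ring.
  eapply Rle_trans; [apply Cmod_triangle|]. lra.
Qed.

Lemma der_mult f g z l m : der i f z l -> der i g z m ->
  der i (fun w => f w * g w)%C z (l * g z + f z * m)%C.
Proof.
  intros Hf Hg e He.
  pose proof (Cmod_ge_0 l) as L0. pose proof (Cmod_ge_0 (f z)) as F0.
  pose proof (Cmod_ge_0 (g z)) as G0.
  set (k := e / (3 * (1 + Cmod l + Cmod (f z) + Cmod (g z)))).
  assert (Hk : 0 < k) by (apply Rdiv_lt_0_compat; lra).
  assert (Ek : e = 3 * (k * (1 + Cmod l + Cmod (f z) + Cmod (g z)))).
  { unfold k. field. lra. }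
  destruct (Hf (Rmin k 1) ltac:(apply Rmin_glb_lt; lra)) as [d1 [Hd1 H1]].
  destruct (Hg k Hk) as [d2 [Hd2 H2]].
  destruct (der_cont _ _ _ Hg (Rmin k 1) ltac:(apply Rmin_glb_lt; lra)) as [d3 [Hd3 H3]].
  exists (Rmin d1 (Rmin d2 d3)). split; [repeat apply Rmin_glb_lt; lra|].
  intros w Hw. apply Rmin_Rgt_l in Hw as [A B]. apply Rmin_Rgt_l in B as [B D].
  specialize (H1 w A). specialize (H2 w B). specialize (H3 w D).
  pose proof (Rmin_l k 1). pose proof (Rmin_r k 1).
  replace (f w * g w - f z * g z - (l * g z + f z * m) * (i w - i z))%C with
    ((f w - f z - l * (i w - i z)) * g z + (f w - f z - l * (i w - i z)) * (g w - g z)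
     + f z * (g w - g z - m * (i w - i z)) + l * (i w - i z) * (g w - g z))%C by ring.
  pose proof (Cmod_ge_0 (i w - i z)) as W0.
  pose proof (Cmod_ge_0 (g w - g z)).
  eapply Rle_trans; [apply Cmod_triangle|].
  eapply Rle_trans; [apply Rplus_le_compat_r, Cmod_triangle|].
  eapply Rle_trans; [apply Rplus_le_compat_r, Rplus_le_compat_r, Cmod_triangle|].
  rewrite !Cmod_mult.
  set (h := Cmod (i w - i z)) in *. set (X := Cmod (f w - f z - l * (i w - i z))) in *.
  set (Y := Cmod (g w - g z - m * (i w - i z))) in *. set (Z := Cmod (g w - g z)) in *.
  assert (X0 : 0 <= X) by apply Cmod_ge_0. assert (Y0 : 0 <= Y) by apply Cmod_ge_0.
  assert (X <= k * h) by nra.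
  assert (X <= h) by nra.
  assert (X * Cmod (g z) <= (k * h) * Cmod (g z)) by (apply Rmult_le_compat_r; lra).
  assert (X * Z <= h * k) by (apply Rmult_le_compat; lra).
  assert (Cmod (f z) * Y <= Cmod (f z) * (k * h)) by (apply Rmult_le_compat_l; lra).
  assert (Cmod l * h * Z <= Cmod l * h * k) by (apply Rmult_le_compat_l; nra).
  rewrite Ek. assert (0 <= k * h) by nra.
  assert (0 <= Cmod l * (k * h)) by nra. nra.
Qed.

Lemma der_ext f g z l m : (forall w : T, f w = g w) -> l = m -> der i f z l -> der i g z m.
Proof. intros H <-. apply (der_ext_loc _ _ _ _ 1 Rlt_0_1). auto. Qed.

Lemma der_opp f z l : der i f z l -> der i (fun w => - f w)%C z (- l)%C.
Proof.
  intros H. eapply der_ext; [| |apply (der_mult _ _ _ _ _ (der_const (- (1))%C z) H)].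
  - intros; simpl; ring.
  - simpl; ring.
Qed.

Lemma der_minus f g z l m : der i f z l -> der i g z m ->
  der i (fun w => f w - g w)%C z (l - m)%C.
Proof. intros Hf Hg. apply (der_plus _ _ _ _ _ Hf (der_opp _ _ _ Hg)). Qed.

Lemma der_scal c f z l : der i f z l -> der i (fun w => c * f w)%C z (c * l)%C.
Proof.
  intros H. eapply der_ext; [| |apply (der_mult _ _ _ _ _ (der_const c z) H)].
  - intros; simpl; ring.
  - simpl; ring.
Qed.

Lemma der_comp f (g : C -> C) z l m : cder g (f z) m -> der i f z l ->
  der i (fun w => g (f w)) z (m * l)%C.
Proof.
  intros Hg Hf e He.
  pose proof (Cmod_ge_0 l) as L0. pose proof (Cmod_ge_0 m) as M0.
  destruct (Hf (Rmin 1 (e / (2 * (1 + Cmod m))))) as [d1 [Hd1 H1]].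
  { apply Rmin_glb_lt; [lra|]. apply Rdiv_lt_0_compat; lra. }
  destruct (Hg (e / (2 * (1 + Cmod l)))) as [d2 [Hd2 H2]].
  { apply Rdiv_lt_0_compat; lra. }
  destruct (der_cont _ _ _ Hf d2 Hd2) as [d3 [Hd3 H3]].
  exists (Rmin d1 d3). split; [apply Rmin_glb_lt; lra|].
  intros w Hw. apply Rmin_Rgt_l in Hw as [A B].
  specialize (H1 w A). specialize (H3 w B). specialize (H2 _ H3).
  replace (g (f w) - g (f z) - m * l * (i w - i z))%C with
    ((g (f w) - g (f z) - m * (f w - f z)) + m * (f w - f z - l * (i w - i z)))%C by ring.
  eapply Rle_trans; [apply Cmod_triangle|]. rewrite Cmod_mult.
  pose proof (Cmod_ge_0 (i w - i z)) as W0.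
  pose proof (Cmod_le_minus (f w - f z) (l * (i w - i z))) as E. rewrite Cmod_mult in E.
  set (h := Cmod (i w - i z)) in *. set (X := Cmod (f w - f z - l * (i w - i z))) in *.
  assert (X <= h). { eapply Rle_trans; [apply H1|]. pose proof (Rmin_l 1 (e / (2 * (1 + Cmod m)))). nra. }
  assert (X <= e / (2 * (1 + Cmod m)) * h).
  { eapply Rle_trans; [apply H1|]. pose proof (Rmin_r 1 (e / (2 * (1 + Cmod m)))). nra. }
  assert (Cmod m * X <= e / 2 * h).
  { apply Rle_trans with ((1 + Cmod m) * (e / (2 * (1 + Cmod m)) * h)).
    - apply Rmult_le_compat; try lra. apply Cmod_ge_0.
    - right. field. lra. }
  assert (e / (2 * (1 + Cmod l)) * Cmod (f w - f z) <= e / 2 * h).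
  { apply Rle_trans with (e / (2 * (1 + Cmod l)) * ((1 + Cmod l) * h)).
    - apply Rmult_le_compat_l; [left; apply Rdiv_lt_0_compat; lra | lra].
    - right. field. lra. }
  lra.
Qed.

End Rules.

Lemma cder_inv z : z <> RtoC 0 -> cder Cinv z (- (/ z * / z))%C.
Proof.
  intros Hz e He. apply Cmod_gt_0 in Hz as Hz'.
  exists (Rmin (Cmod z / 2) (e * Cmod z ^ 3 / 2)). split.
  { apply Rmin_glb_lt; [lra|]. pose proof (pow_lt _ 3 Hz'). nra. }
  intros w Hw. apply Rmin_Rgt_l in Hw as [A B].
  assert (Cmod z / 2 <= Cmod w).
  { pose proof (Cmod_le_minus z w). rewrite Cmod_minus_sym in H. lra. }
  assert (Hw : w <> RtoC 0) by (apply Cmod_gt_0; lra).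
  replace (/ w - / z - - (/ z * / z) * (w - z))%C with
    ((w - z) * ((w - z) * / (z * z * w)))%C.
  2: { field. auto. }
  rewrite Cmod_mult, Rmult_comm. apply Rmult_le_compat_r; [apply Cmod_ge_0|].
  rewrite Cmod_mult, Cmod_inv, !Cmod_mult by (repeat apply Cmult_neq_0; auto).
  assert (0 < Cmod z * Cmod z * Cmod w) by (repeat apply Rmult_lt_0_compat; lra).
  apply Rmult_le_reg_r with (Cmod z * Cmod z * Cmod w); [lra|].
  rewrite Rmult_assoc, Rinv_l by lra. 
  apply Rle_trans with (e * Cmod z ^ 3 / 2); [lra|].
  assert (Cmod z * Cmod z * (Cmod z / 2) <= Cmod z * Cmod z * Cmod w)
    by (apply Rmult_le_compat_l; nra). simpl. nra.
Qed.

(** * Mean value inequality and convexity *)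

Lemma norm_C_R (z : C) : norm (V := C_R_NormedModule) z = Cmod z.
Proof.
  unfold Cmod. change (norm (V := C_R_NormedModule) z) with
    (sqrt (Rabs (fst z) ^ 2 + Rabs (snd z) ^ 2)). now rewrite !pow2_abs.
Qed.

Lemma is_derive_cder (f : C -> C) z l :
  is_derive (K := C_AbsRing) (V := C_NormedModule) f z l -> cder f z l.
Proof.
  intros [_ H] e He. specialize (H z (fun P HP => HP) (mkposreal e He)).
  destruct H as [[d Hd] H]. exists d. split; [exact Hd|]. intros w Hw.
  specialize (H w Hw). rewrite (Cmult_comm l). exact H.
Qed.

Lemma entire_cder (F : C -> C) : entire F -> forall z, cder F z (C_derive F z).
Proof.
  intros H z. apply is_derive_cder. apply C_derive_correct; [exact (RtoC 0) | apply H].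
Qed.

Lemma is_derive_rder (u : R -> C) t l :
  is_derive (K := R_AbsRing) (V := C_R_NormedModule) u t l <-> rder u t l.
Proof.
  split.
  - intros [_ H] e He. specialize (H t (fun P HP => HP) (mkposreal e He)).
    destruct H as [[d Hd] H]. exists d. split; [exact Hd|]. intros w Hw.
    rewrite <- RtoC_minus, Cmod_R in *. specialize (H w Hw). rewrite norm_C_R in H.
    change (minus w t) with (w - t) in H. rewrite scal_R_Cmult in H.
    rewrite Cmult_comm. exact H.
  - intros H. split; [apply is_linear_scal_l|].
    intros x Hx.
    apply (is_filter_lim_locally_unique (V := AbsRing_NormedModule R_AbsRing)) in Hx. subst x.
    intros e. destruct (H e (cond_pos e)) as [d [Hd H1]]. exists (mkposreal d Hd).
    intros w Hw. specialize (H1 w). rewrite <- RtoC_minus, Cmod_R in H1.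
    rewrite norm_C_R. change (minus w t) with (w - t). rewrite scal_R_Cmult.
    rewrite Cmult_comm. exact (H1 Hw).
Qed.

Lemma rder_linear_form (p q : R) u t l : rder u t l ->
  is_derive (fun t => p * Re (u t) + q * Im (u t)) t (p * Re l + q * Im l).
Proof.
  intros H. apply is_derive_Reals. intros e He.
  destruct (H (e / (1 + Rabs p + Rabs q))) as [d [Hd H1]].
  { pose proof (Rabs_pos p). pose proof (Rabs_pos q). apply Rdiv_lt_0_compat; lra. }
  exists (mkposreal d Hd). intros h Hh0 Hh. simpl in Hh. specialize (H1 (t + h)).
  replace (RtoC (t + h)%R - RtoC t)%C with (RtoC h) in H1 by (rewrite RtoC_plus; ring).
  rewrite Cmod_R in H1. specialize (H1 Hh).
  set (X := (u (t + h)%R - u t - l * RtoC h)%C) in *.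
  apply Rabs_pos_lt in Hh0 as Hh1.
  assert (E : (p * Re (u (t + h)) + q * Im (u (t + h)) - (p * Re (u t) + q * Im (u t))) / h
    - (p * Re l + q * Im l) = (p * Re X + q * Im X) / h).
  { unfold X, Re, Im, Cminus, Cplus, Copp, Cmult, RtoC; simpl. field. exact Hh0. }
  rewrite E. unfold Rdiv. rewrite Rabs_mult, Rabs_inv.
  apply Rmult_lt_reg_r with (Rabs h); [lra|].
  rewrite Rmult_assoc, Rinv_l by lra. rewrite Rmult_1_r.
  pose proof (Rabs_pos p) as Hp. pose proof (Rabs_pos q) as Hq.
  eapply Rle_lt_trans; [apply Rabs_triang|]. rewrite !Rabs_mult.
  pose proof (re_le_Cmod X). pose proof (im_le_Cmod X).
  apply Rle_lt_trans with ((Rabs p + Rabs q) * (e / (1 + Rabs p + Rabs q) * Rabs h)).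
  - rewrite Rmult_plus_distr_r. apply Rplus_le_compat; apply Rmult_le_compat_l; lra.
  - replace (e * Rabs h) with ((1 + Rabs p + Rabs q) * (e / (1 + Rabs p + Rabs q) * Rabs h))
      by (field; lra).
    apply Rmult_lt_compat_r; [|lra]. apply Rmult_lt_0_compat; [|lra].
    apply Rdiv_lt_0_compat; lra.
Qed.

(** Apply the real mean value theorem to the component of [u] in the direction [u b - u a]. *)
Lemma mvi (u u' : R -> C) a b K : a <= b ->
  (forall t, a <= t <= b -> rder u t (u' t)) ->
  (forall t, a <= t <= b -> Cmod (u' t) <= K) ->
  Cmod (u b - u a) <= K * (b - a).
Proof.
  intros Hab H HK.
  set (v := (u b - u a)%C).
  destruct (MVT_gen (fun t => Re v * Re (u t) + Im v * Im (u t)) a b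
     (fun t => Re v * Re (u' t) + Im v * Im (u' t))) as [c [Hc E]].
  - rewrite Rmin_left, Rmax_right by lra. intros t Ht. apply rder_linear_form, H. lra.
  - rewrite Rmin_left, Rmax_right by lra. intros t Ht.
    apply derivable_continuous_pt. eexists. apply is_derive_Reals.
    apply rder_linear_form, H. exact Ht.
  - rewrite Rmin_left, Rmax_right in Hc by lra.
    assert (E2 : Cmod v * Cmod v = (Re v * Re (u' c) + Im v * Im (u' c)) * (b - a)).
    { rewrite <- E. replace (Cmod v * Cmod v) with (Cmod v ^ 2) by ring.
      rewrite Cmod2_alt. unfold v, Re, Im, Cminus, Cplus, Copp; simpl. ring. }
    assert (E3 : Re v * Re (u' c) + Im v * Im (u' c) <= Cmod v * Cmod (u' c)).
    { replace (Re v * Re (u' c) + Im v * Im (u' c)) with (Re (Cconj v * u' c)).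
      - rewrite <- (Cmod_conj v), <- Cmod_mult. eapply Rle_trans; [apply Rle_abs|apply re_le_Cmod].
      - unfold Re, Im, Cconj, Cmult; simpl. ring. }
    pose proof (Cmod_ge_0 v) as V0. pose proof (HK c Hc) as Hk.
    assert (Cmod v * Cmod v <= Cmod v * (K * (b - a))).
    { rewrite E2. rewrite <- Rmult_assoc. apply Rmult_le_compat_r; [lra|].
      eapply Rle_trans; [apply E3|]. apply Rmult_le_compat_l; lra. }
    destruct (Req_dec (Cmod v) 0) as [Z|Z].
    + rewrite Z. pose proof (Cmod_ge_0 (u' c)). apply Rmult_le_pos; lra.
    + apply Rmult_le_reg_l with (Cmod v); lra.
Qed.

Definition seg (p q : C) (t : R) : C := (p + RtoC t * (q - p))%C.

Lemma seg_0 p q : seg p q 0 = p.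
Proof. unfold seg. ring. Qed.

Lemma seg_1 p q : seg p q 1 = q.
Proof. unfold seg. ring. Qed.

Lemma rder_seg p q t : rder (seg p q) t (q - p)%C.
Proof.
  eapply der_ext; [| |apply (der_plus _ _ _ _ _ _ (der_const _ p t)
    (der_mult _ _ _ _ _ _ (der_id _ t) (der_const _ (q - p)%C t)))].
  - reflexivity.
  - simpl. ring.
Qed.

Definition convex (U : C -> Prop) : Prop :=
  forall p q t, U p -> U q -> 0 <= t <= 1 -> U (seg p q t).

(** The mean value inequality along the segment from [p] to [q]. *)
Lemma cmvi (U : C -> Prop) (G g : C -> C) K p q : convex U -> U p -> U q ->
  (forall z, U z -> cder G z (g z)) -> (forall z, U z -> Cmod (g z) <= K) ->
  Cmod (G q - G p) <= K * Cmod (q - p).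
Proof.
  intros HU Hp Hq HG HK.
  rewrite <- (seg_1 p q) at 1. rewrite <- (seg_0 p q) at 2.
  eapply Rle_trans.
  - apply (mvi (fun t => G (seg p q t)) (fun t => g (seg p q t) * (q - p))%C 0 1
       (K * Cmod (q - p))); [lra| |].
    + intros t Ht. apply (der_comp RtoC (seg p q) G); [apply HG; auto | apply rder_seg].
    + intros t Ht. rewrite Cmod_mult. apply Rmult_le_compat_r; [apply Cmod_ge_0 | auto].
  - lra.
Qed.

Lemma cdisk_convex c r : convex (fun z => Cmod (z - c) <= r).
Proof.
  intros p q t Hp Hq Ht. unfold seg.
  replace (p + RtoC t * (q - p) - c)%C with (RtoC (1 - t)%R * (p - c) + RtoC t * (q - c))%C.
  - eapply Rle_trans; [apply Cmod_triangle|]. rewrite !Cmod_mult, !Cmod_R.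
    rewrite !Rabs_pos_eq by lra. nra.
  - rewrite RtoC_minus. ring.
Qed.

(** The sublevel sets of such a function are convex, the strict ones open and the others closed.
A triangle in a strict sublevel set thus lies in a closed convex subset of it.  The distance to a
point gives disks and [Re] gives half planes. *)
Definition gauge (phi : C -> R) : Prop :=
  (forall p q t, 0 <= t <= 1 -> phi (seg p q t) <= Rmax (phi p) (phi q)) /\
  (forall z w, phi z <= phi w + Cmod (z - w)).

Lemma gauge_seg phi m p q t : gauge phi -> phi p <= m -> phi q <= m -> 0 <= t <= 1 ->
  phi (seg p q t) <= m.
Proof.
  intros [H _] Hp Hq Ht. eapply Rle_trans; [apply H, Ht|]. apply Rmax_lub; auto.
Qed.

Lemma disk_gauge c : gauge (fun z => Cmod (z - c)).
Proof.
  split.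
  - intros p q t Ht.
    apply (cdisk_convex c (Rmax (Cmod (p - c)) (Cmod (q - c))) p q t); auto.
    + apply Rmax_l.
    + apply Rmax_r.
  - intros z w. rewrite Rplus_comm. apply Cmod_tri3.
Qed.

Lemma Cmod_gauge : gauge Cmod.
Proof.
  destruct (disk_gauge 0) as [H1 H2]. assert (E : forall x, (x - 0)%C = x) by (intros; ring).
  split; intros; [specialize (H1 p q t H) | specialize (H2 z w)]; rewrite ?E in *; assumption.
Qed.

Lemma gauge_convex phi c : gauge phi -> convex (fun z => phi z < c).
Proof.
  intros [H _] p q t Hp Hq Ht. eapply Rle_lt_trans; [apply H, Ht|]. now apply Rmax_lub_lt.
Qed.

Lemma gauge_convex_le phi c : gauge phi -> convex (fun z => phi z <= c).
Proof.
  intros H p q t Hp Hq Ht. now apply gauge_seg.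
Qed.

Lemma disk_convex c r : convex (fun z => Cmod (z - c) < r).
Proof. apply gauge_convex, disk_gauge. Qed.

Lemma disk_open c r z : Cmod (z - c) < r ->
  exists r', 0 < r' /\ forall w, Cmod (w - z) < r' -> Cmod (w - c) < r.
Proof.
  intros Hz. exists (r - Cmod (z - c)). split; [lra|]. intros w Hw.
  eapply Rle_lt_trans; [apply (Cmod_tri3 _ z)|]. lra.
Qed.

(** * Goursat's lemma and primitives *)

Lemma cont_comp {T : Type} (i : T -> C) (u : T -> C) (g : C -> C) x :
  ccont g (u x) -> cont i u x -> cont i (fun y => g (u y)) x.
Proof.
  intros Hg Hu e He. destruct (Hg e He) as [d [Hd H]].
  destruct (Hu d Hd) as [d' [Hd' H']]. exists d'. split; auto.
Qed.

Lemma rcont_continuous (u : R -> C) t : rcont u t ->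
  continuous (U := C_R_CompleteNormedModule) u t.
Proof.
  intros H. apply filterlim_locally. intros eps.
  destruct (H eps (cond_pos eps)) as [d [Hd Hc]]. exists (mkposreal d Hd). intros s Hs.
  apply C_NormedModule_mixin_compat1. apply Hc. rewrite <- RtoC_minus, Cmod_R. exact Hs.
Qed.

Definition seg_integral (f : C -> C) (p q : C) : C :=
  RInt (V := C_R_CompleteNormedModule) (fun t => (q - p) * f (seg p q t))%C 0 1.

Definition seg_cont (f : C -> C) (p q : C) : Prop :=
  forall t, 0 <= t <= 1 -> ccont f (seg p q t).

Lemma seg_integrand_cont f p q t : ccont f (seg p q t) ->
  rcont (fun t => (q - p) * f (seg p q t))%C t.
Proof.
  intros H. apply (cont_comp RtoC (seg p q) (fun z => (q - p) * f z)%C).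
  - intros e He. pose proof (Cmod_ge_0 (q - p)) as P.
    destruct (H (e / (1 + Cmod (q - p)))) as [d [Hd Hc]]; [apply Rdiv_lt_0_compat; lra|].
    exists d. split; [exact Hd|]. intros w Hw. specialize (Hc w Hw).
    replace ((q - p) * f w - (q - p) * f (seg p q t))%C with
      ((q - p) * (f w - f (seg p q t)))%C by ring.
    rewrite Cmod_mult. pose proof (Cmod_ge_0 (f w - f (seg p q t))).
    apply Rmult_lt_compat_l with (r := 1 + Cmod (q - p)) in Hc; [|lra].
    replace ((1 + Cmod (q - p)) * (e / (1 + Cmod (q - p)))) with e in Hc by (field; lra). nra.
  - eapply der_cont, rder_seg.
Qed.

Lemma seg_integral_antider f p q (u : R -> C) : seg_cont f p q ->
  (forall t, 0 <= t <= 1 -> rder u t ((q - p) * f (seg p q t))%C) ->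
  seg_integral f p q = (u 1 - u 0)%C.
Proof.
  intros Hc Hu. apply (is_RInt_unique (V := C_R_CompleteNormedModule)).
  apply (is_RInt_derive (V := C_R_CompleteNormedModule) u).
  - rewrite Rmin_left, Rmax_right by lra. intros t Ht. apply is_derive_rder. auto.
  - rewrite Rmin_left, Rmax_right by lra. intros t Ht.
    apply rcont_continuous, seg_integrand_cont. auto.
Qed.

(** Extending the integrand by constants outside [[0, 1]] makes it continuous on the whole line, so
that the antiderivative has two-sided derivatives also at the end points. *)
Lemma seg_antider_ex f p q : seg_cont f p q ->
  exists u : R -> C, forall t, 0 <= t <= 1 -> rder u t ((q - p) * f (seg p q t))%C.
Proof.
  intros Hc. set (clamp := fun t => Rmax 0 (Rmin 1 t)).
  assert (Hcl : forall t, 0 <= clamp t <= 1).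
  { intros t. unfold clamp, Rmax, Rmin. repeat destruct Rle_dec; lra. }
  assert (Hid : forall t, 0 <= t <= 1 -> clamp t = t).
  { intros t Ht. unfold clamp, Rmax, Rmin. repeat destruct Rle_dec; lra. }
  assert (Hlip : forall s t, Rabs (clamp s - clamp t) <= Rabs (s - t)).
  { intros s t. unfold clamp, Rmax, Rmin, Rabs.
    repeat (destruct Rle_dec || destruct Rcase_abs); lra. }
  set (g := fun t => ((q - p) * f (seg p q (clamp t)))%C).
  assert (Hg : forall t, continuous (U := C_R_CompleteNormedModule) g t).
  { intros t. apply rcont_continuous. intros e He.
    destruct (seg_integrand_cont f p q (clamp t) (Hc _ (Hcl t)) e He) as [d [Hd H]].
    exists d. split; [exact Hd|]. intros s Hs. apply H.
    rewrite <- RtoC_minus, Cmod_R in *. eapply Rle_lt_trans; [apply Hlip | exact Hs]. }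
  exists (fun t => RInt (V := C_R_CompleteNormedModule) g 0 t).
  intros t Ht. apply is_derive_rder. rewrite <- (Hid t Ht) at 2.
  apply (is_derive_RInt (V := C_R_CompleteNormedModule) g _ 0 t).
  - apply filter_forall. intros s. apply (RInt_correct (V := C_R_CompleteNormedModule)).
    apply (ex_RInt_continuous (V := C_R_CompleteNormedModule)). auto.
  - apply Hg.
Qed.

Lemma rder_rescale (u : R -> C) (a b t : R) l : rder u (a * t + b) l ->
  rder (fun t => u (a * t + b)) t (RtoC a * l)%C.
Proof.
  intros H e He. pose proof (Rabs_pos a).
  destruct (H (e / (1 + Rabs a))) as [d [Hd H1]]; [apply Rdiv_lt_0_compat; lra|].
  exists (d / (1 + Rabs a)). split; [apply Rdiv_lt_0_compat; lra|].
  intros s Hs. specialize (H1 (a * s + b)).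
  replace (RtoC (a * s + b) - RtoC (a * t + b))%C with (RtoC a * (RtoC s - RtoC t))%C in H1
    by (rewrite !RtoC_plus, !RtoC_mult; ring).
  rewrite Cmod_mult, Cmod_R in H1.
  replace (RtoC a * l * (RtoC s - RtoC t))%C with (l * (RtoC a * (RtoC s - RtoC t)))%C by ring.
  pose proof (Cmod_ge_0 (RtoC s - RtoC t)) as P. set (h := Cmod (RtoC s - RtoC t)) in *.
  eapply Rle_trans; [apply H1|].
  - apply Rmult_lt_compat_l with (r := 1 + Rabs a) in Hs; [|lra].
    replace ((1 + Rabs a) * (d / (1 + Rabs a))) with d in Hs by (field; lra). nra.
  - apply Rle_trans with (e / (1 + Rabs a) * ((1 + Rabs a) * h)).
    + apply Rmult_le_compat_l; [left; apply Rdiv_lt_0_compat; lra | nra].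
    + right. field. lra.
Qed.

Definition mid (p q : C) : C := seg p q (/ 2).

Lemma seg_integral_rev f p q : seg_cont f p q -> seg_integral f q p = (- seg_integral f p q)%C.
Proof.
  intros Hc. destruct (seg_antider_ex f p q Hc) as [u Hu].
  assert (E : forall t, seg q p t = seg p q (-1 * t + 1)).
  { intros t. unfold seg. rewrite RtoC_plus, RtoC_mult. ring. }
  rewrite (seg_integral_antider f p q u Hc Hu).
  rewrite (seg_integral_antider f q p (fun t => u (-1 * t + 1))).
  - replace (-1 * 1 + 1) with 0 by ring. replace (-1 * 0 + 1) with 1 by ring. ring.
  - intros t Ht. rewrite E. apply Hc. lra.
  - intros t Ht. eapply der_ext; [reflexivity| |apply rder_rescale, Hu; lra].
    rewrite E. ring.
Qed.

Lemma half_half : RtoC (/ 2) = (/ RtoC 2)%C.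
Proof. apply RtoC_inv; lra. Qed.

Lemma mid_left p q : (mid p q - p = RtoC (/ 2) * (q - p))%C.
Proof. unfold mid, seg. ring. Qed.

Lemma mid_right p q : (q - mid p q = RtoC (/ 2) * (q - p))%C.
Proof. unfold mid, seg. rewrite half_half. field. Qed.

Lemma seg_sub_left p q t : seg p (mid p q) t = seg p q (/ 2 * t + 0).
Proof. unfold seg, mid, seg. rewrite RtoC_plus, RtoC_mult. ring. Qed.

Lemma seg_sub_right p q t : seg (mid p q) q t = seg p q (/ 2 * t + / 2).
Proof.
  unfold seg, mid, seg. rewrite RtoC_plus, RtoC_mult.
  assert (E : RtoC (/ 2) = (/ RtoC 2)%C) by (apply RtoC_inv; lra). rewrite E.
  field.
Qed.

Lemma seg_integral_split f p q : seg_cont f p q ->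
  seg_integral f p q = (seg_integral f p (mid p q) + seg_integral f (mid p q) q)%C.
Proof.
  intros Hc. destruct (seg_antider_ex f p q Hc) as [u Hu].
  rewrite (seg_integral_antider f p q u Hc Hu).
  rewrite (seg_integral_antider f p (mid p q) (fun t => u (/ 2 * t + 0))).
  rewrite (seg_integral_antider f (mid p q) q (fun t => u (/ 2 * t + / 2))).
  - replace (/ 2 * 1 + / 2) with 1 by field. replace (/ 2 * 0 + / 2) with (/ 2) by ring.
    replace (/ 2 * 1 + 0) with (/ 2) by ring. replace (/ 2 * 0 + 0) with 0 by ring. ring.
  - intros t Ht. rewrite seg_sub_right. apply Hc. lra.
  - intros t Ht. eapply der_ext; [reflexivity| |apply rder_rescale, Hu; lra].
    rewrite seg_sub_right, mid_right. ring.
  - intros t Ht. rewrite seg_sub_left. apply Hc. lra.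
  - intros t Ht. eapply der_ext; [reflexivity| |apply rder_rescale, Hu; lra].
    rewrite seg_sub_left, mid_left. ring.
Qed.

(** Compare the antiderivative along the segment with that of the affine map [al + be * z]. *)
Lemma seg_integral_affine f p q al be e : seg_cont f p q ->
  (forall t, 0 <= t <= 1 -> Cmod (f (seg p q t) - (al + be * seg p q t)) <= e) ->
  Cmod (seg_integral f p q - ((al * q + be * (q * q) / RtoC 2) - (al * p + be * (p * p) / RtoC 2)))
    <= e * Cmod (q - p).
Proof.
  intros Hc He. destruct (seg_antider_ex f p q Hc) as [u Hu].
  rewrite (seg_integral_antider f p q u Hc Hu).
  assert (N2 : RtoC 2 <> RtoC 0) by (intros H; apply RtoC_inj in H; lra).
  set (L := fun z => (al * z + be * (z * z) / RtoC 2)%C).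
  assert (HL : forall z, cder L z (al + be * z)%C).
  { intros z. pose proof (der_id (fun z : C => z) z) as I.
    eapply der_ext; [| |apply (der_plus _ _ _ _ _ _ (der_scal _ al _ _ _ I)
      (der_scal _ (be / RtoC 2)%C _ _ _ (der_mult _ _ _ _ _ _ I I)))].
    - intros w. unfold L. simpl. field.
    - simpl. field. }
  replace (u 1 - u 0 - ((al * q + be * (q * q) / RtoC 2) - (al * p + be * (p * p) / RtoC 2)))%C
    with ((u 1 - L (seg p q 1)) - (u 0 - L (seg p q 0)))%C.
  2: { rewrite seg_0, seg_1. unfold L. ring. }
  eapply Rle_trans.
  - apply (mvi (fun t => u t - L (seg p q t))%C
      (fun t => (q - p) * f (seg p q t) - (al + be * seg p q t) * (q - p))%C 0 1
      (e * Cmod (q - p))); [lra| |].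
    + intros t Ht. apply der_minus; [apply Hu, Ht|].
      apply (der_comp RtoC (seg p q) L); [apply HL | apply rder_seg].
    + intros t Ht.
      replace ((q - p) * f (seg p q t) - (al + be * seg p q t) * (q - p))%C with
       ((f (seg p q t) - (al + be * seg p q t)) * (q - p))%C by ring.
      rewrite Cmod_mult. apply Rmult_le_compat_r; [apply Cmod_ge_0 | auto].
  - lra.
Qed.

Definition holomorphic_on (U : C -> Prop) (f : C -> C) : Prop :=
  forall z, U z -> exists l, cder f z l.

Definition triangle : Type := (C * C * C)%type.

Definition tri_integral (f : C -> C) (T : triangle) : C :=
  let '(p, q, r) := T in (seg_integral f p q + seg_integral f q r + seg_integral f r p)%C.

Definition perimeter (T : triangle) : R :=
  let '(p, q, r) := T in Cmod (q - p) + Cmod (r - q) + Cmod (p - r).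

Definition subtriangle (T : triangle) (k : nat) : triangle :=
  let '(p, q, r) := T in
  match k with
  | 0 => (p, mid p q, mid r p)
  | 1 => (mid p q, q, mid q r)
  | 2 => (mid r p, mid q r, r)
  | _ => (mid p q, mid q r, mid r p)
  end%nat.

Definition tri_in (phi : C -> R) (m : R) (T : triangle) : Prop :=
  let '(p, q, r) := T in phi p <= m /\ phi q <= m /\ phi r <= m.

Lemma subtriangle_in phi m T k : gauge phi -> tri_in phi m T -> tri_in phi m (subtriangle T k).
Proof.
  intros Hphi. destruct T as [[p q] r]. simpl. intros (Hp & Hq & Hr).
  destruct k as [|[|[|k]]]; simpl; unfold mid; repeat split; auto; apply gauge_seg; auto; lra.
Qed.

Lemma Cmod_half z : Cmod (RtoC (/ 2) * z) = Cmod z / 2.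
Proof. rewrite Cmod_mult, Cmod_R, Rabs_pos_eq; lra. Qed.

Lemma subtriangle_perimeter T k : perimeter (subtriangle T k) = perimeter T / 2.
Proof.
  destruct T as [[p q] r].
  assert (E : forall x y z, Cmod (mid z y - mid x z) = Cmod (y - x) / 2).
  { intros x y z. rewrite <- Cmod_half. f_equal. unfold mid, seg. rewrite half_half.
    field. }
  assert (E1 : forall x y, Cmod (mid x y - x) = Cmod (y - x) / 2).
  { intros x y. rewrite <- Cmod_half. f_equal. unfold mid, seg. ring. }
  assert (E2 : forall x y, Cmod (y - mid x y) = Cmod (y - x) / 2).
  { intros x y. rewrite <- Cmod_half. f_equal. unfold mid, seg. rewrite half_half.
    field. }
  assert (Ec : forall x y, mid x y = mid y x).
  { intros x y. unfold mid, seg. rewrite half_half. field. }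
  destruct k as [|[|[|k]]]; simpl.
  - rewrite E1, E2. rewrite (Cmod_minus_sym (mid r p)), (E r q p), (Cmod_minus_sym q r). lra.
  - rewrite E1, E2. rewrite (Cmod_minus_sym (mid p q)), (E p r q), (Cmod_minus_sym p r). lra.
  - rewrite E1, E2. rewrite (Cmod_minus_sym (mid q r)), (E q p r), (Cmod_minus_sym q p). lra.
  - rewrite (E p r q), (E q p r), (E r q p).
    rewrite (Cmod_minus_sym p r), (Cmod_minus_sym q p), (Cmod_minus_sym q r). lra.
Qed.

(** The edges of the middle triangle cancel against one edge of each corner triangle. *)
Lemma tri_integral_split f phi m T : gauge phi -> (forall z, phi z <= m -> ccont f z) ->
  tri_in phi m T ->
  tri_integral f T = (tri_integral f (subtriangle T 0) + tri_integral f (subtriangle T 1)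
     + tri_integral f (subtriangle T 2) + tri_integral f (subtriangle T 3))%C.
Proof.
  intros Hphi Hf. destruct T as [[p q] r]. intros (Hp & Hq & Hr).
  assert (Hc : forall x y, phi x <= m -> phi y <= m -> seg_cont f x y).
  { intros x y Hx Hy t Ht. apply Hf, gauge_seg; auto. }
  assert (Hm : forall x y, phi x <= m -> phi y <= m -> phi (mid x y) <= m).
  { intros x y Hx Hy. apply gauge_seg; auto. lra. }
  simpl. rewrite (seg_integral_split f p q), (seg_integral_split f q r),
    (seg_integral_split f r p) by auto.
  rewrite (seg_integral_rev f (mid p q) (mid q r)), (seg_integral_rev f (mid q r) (mid r p)),
    (seg_integral_rev f (mid r p) (mid p q)) by auto.
  ring.
Qed.

(** If the integral exceeded [e] times the squared perimeter, so would the integral over one of the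
four half-size triangles, as the squared perimeters of these add up to that of the whole.
Iterating, the triangles shrink to a point at which [f] is differentiable, hence so close to an
affine map that the excess is impossible. *)
Lemma goursat phi m f T : gauge phi -> holomorphic_on (fun z => phi z <= m) f ->
  tri_in phi m T -> tri_integral f T = RtoC 0.
Proof.
  intros Hphi Hf HT.
  assert (Hcont : forall z, phi z <= m -> ccont f z).
  { intros z Hz. destruct (Hf z Hz) as [l Hl]. eapply der_cont, Hl. }
  assert (per0 : forall T, 0 <= perimeter T).
  { intros [[p q] r]. simpl. pose proof (Cmod_ge_0 (q - p)). pose proof (Cmod_ge_0 (r - q)).
    pose proof (Cmod_ge_0 (p - r)). lra. }
  assert (main : forall e, 0 < e -> Cmod (tri_integral f T) <= e * (perimeter T * perimeter T)).
  2: { apply Cmod_eq_0. apply Rle_antisym; [|apply Cmod_ge_0].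
    apply le_epsilon. intros e He.
    pose proof (per0 T) as P0.
    eapply Rle_trans; [apply (main (e / (1 + perimeter T * perimeter T)))|].
    - apply Rdiv_lt_0_compat; nra.
    - rewrite Rplus_0_l. apply Rle_trans with
        (e / (1 + perimeter T * perimeter T) * (1 + perimeter T * perimeter T)).
      + apply Rmult_le_compat_l; [left; apply Rdiv_lt_0_compat; nra | lra].
      + right. field. nra. }
  intros e He.
  set (bad := fun T => tri_in phi m T /\ e * (perimeter T * perimeter T) < Cmod (tri_integral f T)).
  apply Rnot_lt_le. intros Hbad.
  assert (step : forall T, bad T -> exists k, bad (subtriangle T k)).
  { intros S [HS1 HS2]. apply NNPP. intros Hn.
    assert (Hk : forall k, Cmod (tri_integral f (subtriangle S k)) <=
       e * (perimeter S / 2 * (perimeter S / 2))).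
    { intros k. apply Rnot_lt_le. intros Hlt. apply Hn. exists k. split.
      - apply subtriangle_in; auto.
      - rewrite subtriangle_perimeter. exact Hlt. }
    rewrite (tri_integral_split f phi m S) in HS2 by auto.
    pose proof (Hk 0%nat). pose proof (Hk 1%nat). pose proof (Hk 2%nat). pose proof (Hk 3%nat).
    revert HS2. apply Rle_not_lt.
    eapply Rle_trans; [apply Cmod_triangle|].
    eapply Rle_trans; [apply Rplus_le_compat_r, Cmod_triangle|].
    eapply Rle_trans; [apply Rplus_le_compat_r, Rplus_le_compat_r, Cmod_triangle|]. lra. }
  set (next := fun S => subtriangle S (epsilon (inhabits 0%nat) (fun k => bad (subtriangle S k)))).
  set (Tn := fun n => Nat.iter n next T).
  assert (HTn : forall n, bad (Tn n)).
  { induction n as [|n IH]; [split; assumption|].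
    apply (epsilon_spec (inhabits 0%nat) _ (step _ IH)). }
  assert (Hper : forall n, perimeter (Tn n) = perimeter T / 2 ^ n).
  { induction n as [|n IH]; [simpl; field|].
    change (Tn (S n)) with (next (Tn n)). unfold next. rewrite subtriangle_perimeter, IH.
    simpl. field. apply pow_nonzero. lra. }
  set (v := fun S : triangle => fst (fst S)).
  assert (Hv : forall S k, Cmod (v (subtriangle S k) - v S) <= perimeter S).
  { intros [[p q] r] k. pose proof (Cmod_ge_0 (q - p)). pose proof (Cmod_ge_0 (r - q)).
    pose proof (Cmod_ge_0 (p - r)).
    assert (E1 : Cmod (mid p q - p) = Cmod (q - p) / 2).
    { rewrite <- Cmod_half. f_equal. unfold mid, seg. ring. }
    assert (E2 : Cmod (mid r p - p) = Cmod (p - r) / 2).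
    { rewrite Cmod_minus_sym, <- Cmod_half. f_equal. unfold mid, seg. rewrite half_half.
      field. }
    destruct k as [|[|[|k]]]; unfold v; simpl; rewrite ?Cmod_minus_diag, ?E1, ?E2; lra. }
  destruct (geometric_limit (fun n => v (Tn n)) (perimeter T)) as [l Hl].
  { intros n. rewrite <- Hper. apply Hv. }
  assert (Hvm : forall n, phi (v (Tn n)) <= m).
  { intros n. destruct (HTn n) as [H _]. destruct (Tn n) as [[p q] r]. apply H. }
  pose proof (per0 T) as P0.
  assert (Hlm : phi l <= m).
  { apply le_epsilon. intros d Hd. destruct (pow2_small _ (d / 2) P0) as [n Hn]; [lra|].
    eapply Rle_trans; [apply (proj2 Hphi l (v (Tn n)))|]. apply Rplus_le_compat; [apply Hvm|].
    rewrite Cmod_minus_sym. eapply Rle_trans; [apply Hl|]. unfold Rdiv in *. lra. }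
  destruct (Hf l Hlm) as [l' Hl']. destruct (Hl' (e / 4)) as [d [Hd Hd']]; [lra|].
  destruct (pow2_small _ (d / 3) P0) as [n Hn]; [lra|].
  destruct (HTn n) as [HA HB]. specialize (Hl n). rewrite Hper in HB.
  pose proof (Hper n) as Hpn.
  set (P := perimeter T / 2 ^ n) in *.
  assert (PP : 0 <= P) by (rewrite <- Hpn; apply per0).
  replace (2 * perimeter T / 2 ^ n) with (2 * P) in Hl by (unfold P, Rdiv; ring).
  destruct (Tn n) as [[p q] r]. simpl in Hl, Hpn, HA, HB. unfold v in Hl. simpl in Hl.
  assert (Hseg : forall x y, Cmod (x - p) <= P -> Cmod (y - p) <= P -> phi x <= m -> phi y <= m ->
    Cmod (seg_integral f x y -
      (((f l - l' * l) * y + l' * (y * y) / RtoC 2) -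
       ((f l - l' * l) * x + l' * (x * x) / RtoC 2))) <= (e / 4 * (3 * P)) * Cmod (y - x)).
  { intros x y Hx Hy Mx My. apply seg_integral_affine.
    - intros t Ht. apply Hcont, gauge_seg; auto.
    - intros t Ht.
      assert (Hz : Cmod (seg x y t - l) <= 3 * P).
      { eapply Rle_trans; [apply (Cmod_tri3 _ p)|].
        pose proof (cdisk_convex p P x y t Hx Hy Ht) as Hz. simpl in Hz. lra. }
      replace (f (seg x y t) - (f l - l' * l + l' * seg x y t))%C with
        (f (seg x y t) - f l - l' * (seg x y t - l))%C by ring.
      eapply Rle_trans; [apply Hd'; lra|]. apply Rmult_le_compat_l; lra. }
  pose proof (Cmod_ge_0 (q - p)). pose proof (Cmod_ge_0 (r - q)). pose proof (Cmod_ge_0 (p - r)).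
  assert (Dp : Cmod (p - p) <= P) by (rewrite Cmod_minus_diag; lra).
  assert (Dq : Cmod (q - p) <= P) by lra.
  assert (Dr : Cmod (r - p) <= P) by (rewrite Cmod_minus_sym; lra).
  destruct HA as (Mp & Mq & Mr).
  (* the affine approximation contributes nothing: the increments of its primitive [Q] cancel *)
  pose proof (Hseg p q Dp Dq Mp Mq) as S1. pose proof (Hseg q r Dq Dr Mq Mr) as S2.
  pose proof (Hseg r p Dr Dp Mr Mp) as S3.
  revert HB. apply Rle_not_lt.
  set (Q := fun z => ((f l - l' * l) * z + l' * (z * z) / RtoC 2)%C).
  replace (seg_integral f p q + seg_integral f q r + seg_integral f r p)%C with
    ((seg_integral f p q - (Q q - Q p)) + (seg_integral f q r - (Q r - Q q))
      + (seg_integral f r p - (Q p - Q r)))%C by ring.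
  eapply Rle_trans; [apply Cmod_triangle|].
  eapply Rle_trans; [apply Rplus_le_compat_r, Cmod_triangle|].
  apply Rle_trans with (e / 4 * (3 * P) * (Cmod (q - p) + Cmod (r - q) + Cmod (p - r))).
  - unfold Q. lra.
  - rewrite Hpn. nra.
Qed.

(** Integrate from a base point; Goursat's lemma turns increments into integrals over short
segments. *)
Theorem primitive_exists phi c f : gauge phi -> holomorphic_on (fun z => phi z < c) f ->
  exists P, forall z, phi z < c -> cder P z (f z).
Proof.
  intros Hphi Hf.
  destruct (classic (exists z0, phi z0 < c)) as [[z0 Hz0]|Hn].
  2: { exists f. intros z Hz. destruct Hn. eauto. }
  assert (Hcont : forall z, phi z < c -> ccont f z).
  { intros z Hz. destruct (Hf z Hz) as [l Hl]. eapply der_cont, Hl. }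
  assert (Hseg : forall x y t, phi x < c -> phi y < c -> 0 <= t <= 1 -> phi (seg x y t) < c).
  { intros x y t Hx Hy Ht. eapply Rle_lt_trans; [apply (proj1 Hphi), Ht|]. apply Rmax_lub_lt; auto. }
  exists (seg_integral f z0). intros z Hz e He.
  destruct (Hcont z Hz e He) as [d [Hd Hd']].
  exists (Rmin d (c - phi z)). split; [apply Rmin_glb_lt; lra|].
  intros w Hw. apply Rmin_Rgt_l in Hw as [A B].
  assert (Hw : phi w < c).
  { eapply Rle_lt_trans; [apply (proj2 Hphi w z)|]. lra. }
  assert (HT : tri_integral f (z0, z, w) = RtoC 0).
  { set (m := Rmax (phi z0) (Rmax (phi z) (phi w))).
    apply (goursat phi m); auto.
    - intros x Hx. apply Hf. eapply Rle_lt_trans; [apply Hx|].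
      unfold m. repeat apply Rmax_lub_lt; auto.
    - unfold m. repeat split.
      + apply Rmax_l.
      + eapply Rle_trans; [|apply Rmax_r]. apply Rmax_l.
      + eapply Rle_trans; [|apply Rmax_r]. apply Rmax_r. }
  simpl in HT. rewrite (seg_integral_rev f z0 w) in HT by (intros t Ht; auto).
  assert (E : seg_integral f z w = (seg_integral f z0 w - seg_integral f z0 z)%C).
  { replace (seg_integral f z w) with (seg_integral f z w - 0)%C by ring. rewrite <- HT. ring. }
  rewrite <- E.
  assert (E2 : (f z * (w - z) = (f z * w + 0 * (w * w) / RtoC 2) - (f z * z + 0 * (z * z) / RtoC 2))%C).
  { field. }
  rewrite E2. apply seg_integral_affine.
  - intros t Ht. auto.
  - intros t Ht. replace (f z + 0 * seg z w t)%C with (f z) by ring. left. apply Hd'.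
    apply (disk_convex z d z w t); auto. rewrite Cmod_minus_diag. lra.
Qed.

(** * Cauchy's estimate *)

Lemma half_plane_gauge : gauge Re.
Proof.
  split.
  - intros p q t Ht.
    replace (Re (seg p q t)) with ((1 - t) * Re p + t * Re q)
      by (unfold seg, Re, Cminus, Cplus, Copp, Cmult, RtoC; simpl; ring).
    pose proof (Rmax_l (Re p) (Re q)). pose proof (Rmax_r (Re p) (Re q)). nra.
  - intros z w. pose proof (re_le_Cmod (z - w)) as H.
    change (Re (z - w)) with (Re z - Re w) in H. pose proof (Rle_abs (Re z - Re w)). lra.
Qed.

Definition cexp (z : C) : C := (RtoC (exp (Re z)) * (cos (Im z), sin (Im z)))%C.

Lemma cexp_add z w : cexp (z + w) = (cexp z * cexp w)%C.
Proof.
  unfold cexp, Cmult, RtoC; simpl. change (Re (z + w)) with (Re z + Re w).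
  change (Im (z + w)) with (Im z + Im w). rewrite exp_plus, cos_plus, sin_plus.
  unfold Re, Im. f_equal; ring.
Qed.

Lemma Cmod_cexp z : Cmod (cexp z) = exp (Re z).
Proof.
  unfold cexp. rewrite Cmod_mult, Cmod_R, Rabs_pos_eq by (left; apply exp_pos).
  unfold Cmod. simpl fst. simpl snd.
  replace (cos (Im z) ^ 2 + sin (Im z) ^ 2) with 1; [rewrite sqrt_1; ring|].
  pose proof (sin2_cos2 (Im z)) as H. unfold Rsqr in H. lra.
Qed.

Lemma cexp_neq_0 z : cexp z <> RtoC 0.
Proof. apply Cmod_gt_0. rewrite Cmod_cexp. apply exp_pos. Qed.

Lemma cexp_2PI z : cexp (z + (0, 2 * PI)) = cexp z.
Proof.
  unfold cexp. change (Re (z + (0, 2 * PI))) with (Re z + 0).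
  change (Im (z + (0, 2 * PI))) with (Im z + 2 * PI).
  now rewrite Rplus_0_r, cos_plus, sin_plus, cos_2PI, sin_2PI, !Rmult_0_r, !Rmult_1_r,
    Rminus_0_r, Rplus_0_r.
Qed.

Lemma rder_pair (x y : R -> R) t a b :
  is_derive x t a -> is_derive y t b -> rder (fun t => (x t, y t) : C) t (a, b).
Proof.
  intros Hx Hy e He. apply is_derive_Reals in Hx, Hy.
  destruct (Hx (e / 2)) as [d1 H1]; [lra|]. destruct (Hy (e / 2)) as [d2 H2]; [lra|].
  exists (Rmin d1 d2). split; [apply Rmin_glb_lt; apply cond_pos|].
  intros s Hs. rewrite <- RtoC_minus, Cmod_R in *. apply Rmin_Rgt_l in Hs as [A B].
  destruct (Req_dec (s - t) 0) as [Z|Z].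
  { replace s with t by lra. rewrite Rminus_diag, Rabs_R0, Rmult_0_r.
    replace ((x t, y t) - (x t, y t) - (a, b) * RtoC 0)%C with (RtoC 0) by ring.
    rewrite Cmod_0. lra. }
  specialize (H1 (s - t) Z A). specialize (H2 (s - t) Z B).
  replace (t + (s - t)) with s in * by ring.
  assert (K : forall z : R -> R, forall c, Rabs ((z s - z t) / (s - t) - c) < e / 2 ->
     Rabs (z s - z t - c * (s - t)) <= e / 2 * Rabs (s - t)).
  { intros z c Hz.
    replace (z s - z t - c * (s - t)) with (((z s - z t) / (s - t) - c) * (s - t))
      by (field; exact Z).
    rewrite Rabs_mult. apply Rmult_le_compat_r; [apply Rabs_pos | lra]. }
  apply K in H1, H2. eapply Rle_trans; [apply Cmod_le_sum|].
  replace (Re ((x s, y s) - (x t, y t) - (a, b) * RtoC (s - t))) with (x s - x t - a * (s - t))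
    by (unfold Re, Cminus, Cplus, Copp, Cmult, RtoC; simpl; ring).
  replace (Im ((x s, y s) - (x t, y t) - (a, b) * RtoC (s - t))) with (y s - y t - b * (s - t))
    by (unfold Im, Cminus, Cplus, Copp, Cmult, RtoC; simpl; ring).
  lra.
Qed.

Lemma rder_cexp_ray h t : rder (fun t => cexp (RtoC t * h)) t (h * cexp (RtoC t * h))%C.
Proof.
  destruct h as [x y].
  eapply (der_ext RtoC (fun t => (exp (t * x) * cos (t * y), exp (t * x) * sin (t * y)) : C)).
  3: { apply rder_pair; auto_derive; auto. }
  - intros s. unfold cexp, Re, Im, Cmult, RtoC; simpl.
    replace (s * x - 0 * y) with (s * x) by ring. replace (s * y + 0 * x) with (s * y) by ring.
    f_equal; ring.
  - unfold cexp, Re, Im, Cmult, RtoC; simpl.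
    replace (t * x - 0 * y) with (t * x) by ring. replace (t * y + 0 * x) with (t * y) by ring.
    f_equal; ring.
Qed.

(** Use the mean value inequality twice along the segment from 0 to [h]. *)
Lemma cexp_first_order h : Cmod h <= 1 -> Cmod (cexp h - RtoC 1 - h) <= 3 * (Cmod h * Cmod h).
Proof.
  intros Hh. pose proof (Cmod_ge_0 h) as H0.
  assert (E0 : cexp (RtoC 0 * h) = RtoC 1).
  { unfold cexp. replace (RtoC 0 * h)%C with (RtoC 0) by ring. unfold Re, Im, RtoC; simpl.
    rewrite exp_0, cos_0, sin_0. unfold Cmult; simpl. f_equal; ring. }
  assert (B : forall t, 0 <= t <= 1 -> Cmod (cexp (RtoC t * h)) <= 3).
  { intros t Ht. rewrite Cmod_cexp. eapply Rle_trans; [|apply exp_le_3].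
    assert (Hr : Re (RtoC t * h) <= 1).
    { eapply Rle_trans; [apply Rle_abs|]. eapply Rle_trans; [apply re_le_Cmod|].
      rewrite Cmod_mult, Cmod_R, Rabs_pos_eq by lra. nra. }
    destruct (Req_dec (Re (RtoC t * h)) 1) as [->|]; [lra|]. left. apply exp_increasing. lra. }
  assert (B1 : forall t, 0 <= t <= 1 -> Cmod (cexp (RtoC t * h) - RtoC 1) <= 3 * Cmod h).
  { intros t Ht. rewrite <- E0.
    eapply Rle_trans; [apply (mvi (fun t => cexp (RtoC t * h)) (fun t => h * cexp (RtoC t * h))%C
      0 t (3 * Cmod h)); [lra| |]|].
    - intros s _. apply rder_cexp_ray.
    - intros s Hs. rewrite Cmod_mult, Rmult_comm. apply Rmult_le_compat_r; [lra|].
      apply B. lra.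
    - nra. }
  replace (cexp h - RtoC 1 - h)%C with
    ((cexp (RtoC 1 * h) - RtoC 1 * h) - (cexp (RtoC 0 * h) - RtoC 0 * h))%C.
  2: { rewrite E0. replace (RtoC 1 * h)%C with h by ring. ring. }
  eapply Rle_trans; [apply (mvi (fun t => cexp (RtoC t * h) - RtoC t * h)%C
     (fun t => h * cexp (RtoC t * h) - (RtoC 1 * h + RtoC t * RtoC 0))%C 0 1
     (3 * (Cmod h * Cmod h))); [lra| |]|].
  - intros s _. apply der_minus; [apply rder_cexp_ray|].
    apply (der_mult _ RtoC (fun _ => h)); [apply der_id | apply der_const].
  - intros s Hs. replace (h * cexp (RtoC s * h) - (RtoC 1 * h + RtoC s * RtoC 0))%C with
      (h * (cexp (RtoC s * h) - RtoC 1))%C by ring.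
    rewrite Cmod_mult. specialize (B1 s Hs). nra.
  - lra.
Qed.

Lemma cder_cexp z : cder cexp z (cexp z).
Proof.
  intros e He. pose proof (exp_pos (Re z)) as E.
  exists (Rmin 1 (e / (3 * exp (Re z)))). split.
  { apply Rmin_glb_lt; [lra|]. apply Rdiv_lt_0_compat; lra. }
  intros w Hw. apply Rmin_Rgt_l in Hw as [A B].
  replace (cexp w) with (cexp (z + (w - z))) by (f_equal; ring).
  rewrite cexp_add.
  replace (cexp z * cexp (w - z) - cexp z - cexp z * (w - z))%C with
    (cexp z * (cexp (w - z) - RtoC 1 - (w - z)))%C by ring.
  rewrite Cmod_mult, Cmod_cexp. pose proof (Cmod_ge_0 (w - z)) as W.
  apply Rle_trans with (exp (Re z) * (3 * (Cmod (w - z) * Cmod (w - z)))).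
  - apply Rmult_le_compat_l; [lra|]. apply cexp_first_order. lra.
  - apply Rmult_gt_compat_l with (r := 3 * exp (Re z)) in B; [|lra].
    replace (3 * exp (Re z) * (e / (3 * exp (Re z)))) with e in B by (field; lra). nra.
Qed.

(** Put [Q s = (f (c + exp s) - f c) / exp s], which is holomorphic on a half plane and has period
2 pi i.  If [S] is a primitive of [Q], then [E s = S (s + 2 pi i) - S s] has derivative 0, hence is
constant.  On the line over the circle of radius [r] it is at most 2 pi [M / r]; far to the left,
where [Q] tends to [l], it tends to 2 pi i [l]. *)
Theorem cauchy_estimate (f : C -> C) (c l : C) (rho r M : R) : 0 < r -> r < rho ->
  holomorphic_on (fun z => Cmod (z - c) < rho) f ->
  (forall z, Cmod (z - c) = r -> Cmod (f z - f c) <= M) ->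
  cder f c l -> Cmod l <= M / r.
Proof.
  intros Hr Hrho Hf HM Hl.
  set (Q := fun s => ((f (c + cexp s) - f c) * / cexp s)%C).
  assert (Hin : forall s, Re s < ln rho -> Cmod (c + cexp s - c) < rho).
  { intros s Hs. replace (c + cexp s - c)%C with (cexp s) by ring.
    rewrite Cmod_cexp. rewrite <- (exp_ln rho) by lra. apply exp_increasing, Hs. }
  destruct (primitive_exists Re (ln rho) Q half_plane_gauge) as [S HS].
  { intros s Hs. destruct (Hf _ (Hin s Hs)) as [k Hk]. eexists.
    apply der_mult.
    - apply der_minus; [|apply der_const].
      apply (der_comp _ (fun s => c + cexp s)%C f); [apply Hk|].
      apply der_plus; [apply der_const | apply cder_cexp].
    - apply (der_comp _ cexp Cinv); [apply cder_inv, cexp_neq_0 | apply cder_cexp]. }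
  set (T := ((0, 2 * PI) : C)).
  pose proof PI_RGT_0 as HPI.
  assert (ReT : forall s, Re (s + T) = Re s) by (intros s; apply Rplus_0_r).
  assert (QT : forall s, Q (s + T)%C = Q s).
  { intros s. unfold Q, T. now rewrite cexp_2PI. }
  set (E := fun s => (S (s + T) - S s)%C).
  assert (HE : forall s, Re s < ln rho -> cder E s (RtoC 0)).
  { intros s Hs. eapply der_ext; [reflexivity| |apply der_minus; [|apply HS, Hs]].
    2: { apply (der_comp _ (fun s => s + T)%C S); [apply HS; rewrite ReT; exact Hs|].
         apply der_plus; [apply der_id | apply der_const]. }
    simpl. rewrite QT. ring. }
  assert (Econst : forall s s', Re s < ln rho -> Re s' < ln rho -> E s = E s').
  { intros s s' Hs Hs'. apply Cmod_minus_0.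
    eapply Rle_trans; [apply (cmvi (fun z => Re z < ln rho) E (fun _ => RtoC 0) 0)|].
    - apply gauge_convex, half_plane_gauge.
    - exact Hs'.
    - exact Hs.
    - exact HE.
    - intros; rewrite Cmod_0; lra.
    - lra. }
  assert (CT : Cmod T = 2 * PI).
  { unfold T, Cmod; simpl. replace (0 * (0 * 1) + 2 * PI * (2 * PI * 1)) with ((2 * PI)²)
      by (unfold Rsqr; ring). apply sqrt_Rsqr. lra. }
  (* the period has length 2 pi, so [E] on a vertical line is 2 pi times an average of [Q] there *)
  assert (Ebound : forall k x K, x < ln rho ->
     (forall s, Re s = x -> Cmod (Q s - k) <= K) ->
     Cmod (E (RtoC x) - k * T) <= K * (2 * PI)).
  { intros k x K Hx HK.
    assert (CV : convex (fun s => Re s = x)).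
    { intros p q t Hp Hq Ht. rewrite <- Hp. replace (Re (seg p q t)) with ((1 - t) * Re p + t * Re q)
       by (unfold seg, Re, Cminus, Cplus, Copp, Cmult, RtoC; simpl; ring). rewrite Hp, Hq. ring. }
    replace (E (RtoC x) - k * T)%C with
      ((S (RtoC x + T) - k * (RtoC x + T)) - (S (RtoC x) - k * RtoC x))%C by (unfold E; ring).
    rewrite <- CT. replace T with ((RtoC x + T) - RtoC x)%C at 3 by ring.
    apply (cmvi (fun s => Re s = x) (fun s => S s - k * s)%C (fun s => Q s - k)%C); auto.
    - intros s Hs. apply der_minus; [apply HS; lra|].
      eapply der_ext; [reflexivity| |apply der_scal, der_id]. ring. }
  assert (R1 : Cmod (E (RtoC (ln r))) <= M / r * (2 * PI)).
  { replace (E (RtoC (ln r))) with (E (RtoC (ln r)) - RtoC 0 * T)%C by ring.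
    apply Ebound; [apply ln_increasing; lra|]. intros s Hs.
    replace (Q s - RtoC 0)%C with (Q s) by ring. unfold Q.
    rewrite Cmod_mult, Cmod_inv, Cmod_cexp, Hs, exp_ln by (auto using cexp_neq_0).
    apply Rmult_le_compat_r; [left; apply Rinv_0_lt_compat, Hr|]. apply HM.
    replace (c + cexp s - c)%C with (cexp s) by ring. rewrite Cmod_cexp, Hs. apply exp_ln, Hr. }
  apply le_epsilon. intros e He.
  destruct (Hl e He) as [d [Hd Hd']].
  set (x := ln (Rmin (d / 2) r)).
  assert (Hm : 0 < Rmin (d / 2) r) by (apply Rmin_glb_lt; lra).
  pose proof (Rmin_l (d / 2) r). pose proof (Rmin_r (d / 2) r).
  assert (Hx : x < ln rho) by (apply ln_increasing; lra).
  assert (R2 : Cmod (E (RtoC x) - l * T) <= e * (2 * PI)).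
  { apply Ebound; [exact Hx|]. intros s Hs.
    assert (Cs : Cmod (cexp s) = Rmin (d / 2) r) by (rewrite Cmod_cexp, Hs; apply exp_ln, Hm).
    unfold Q.
    replace ((f (c + cexp s) - f c) * / cexp s - l)%C with
      ((f (c + cexp s) - f c - l * (c + cexp s - c)) * / cexp s)%C by (field; apply cexp_neq_0).
    rewrite Cmod_mult, Cmod_inv by apply cexp_neq_0.
    assert (P : 0 < Cmod (cexp s)) by lra.
    apply Rmult_le_reg_r with (Cmod (cexp s)); [lra|].
    rewrite Rmult_assoc, Rinv_l by lra. rewrite Rmult_1_r.
    specialize (Hd' (c + cexp s)%C). replace (c + cexp s - c)%C with (cexp s) in * by ring.
    apply Hd'. lra. }
  rewrite (Econst (RtoC (ln r)) (RtoC x)) in R1 by (auto; apply ln_increasing; lra).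
  apply Rmult_le_reg_r with (2 * PI); [lra|]. rewrite <- CT at 1. rewrite <- Cmod_mult.
  eapply Rle_trans; [apply (Cmod_le_minus _ (E (RtoC x)))|]. rewrite Cmod_minus_sym. lra.
Qed.

(** Compactness.  The modulus at a point is chosen at most [1 / (1 + Cmod (f p))], so that a uniform
lower bound on the moduli is at the same time an upper bound for [f]. *)
Lemma continuous_bounded_disk (f : C -> C) M : (forall z, ccont f z) ->
  exists A, 0 < A /\ forall z, Cmod z <= M -> Cmod (f z) <= A.
Proof.
  intros Hf.
  assert (Hd : forall u v : R, exists d : posreal,
    (forall w, Cmod (w - (u, v)) < 2 * d -> Cmod (f w - f (u, v)) < 1) /\
    d <= / (1 + Cmod (f (u, v)))).
  { intros u v. destruct (Hf (u, v) 1 Rlt_0_1) as [d [Hd H]].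
    pose proof (Cmod_ge_0 (f (u, v))) as P.
    assert (Q : 0 < / (1 + Cmod (f (u, v)))) by (apply Rinv_0_lt_compat; lra).
    exists (mkposreal (Rmin (d / 2) (/ (1 + Cmod (f (u, v))))) ltac:(apply Rmin_glb_lt; lra)).
    simpl. split; [|apply Rmin_r]. intros w Hw. apply H.
    pose proof (Rmin_l (d / 2) (/ (1 + Cmod (f (u, v))))). lra. }
  set (delta := fun u v => proj1_sig (constructive_indefinite_description _ (Hd u v))).
  destruct (compactness_value_2d (- M) M (- M) M delta) as [d H].
  exists (1 + / d). pose proof (Rinv_0_lt_compat _ (cond_pos d)) as Pd.
  split; [lra|]. intros [x y] Hz. apply Rnot_lt_le. intros Hlt.
  pose proof (re_le_Cmod (x, y)) as Hx. pose proof (im_le_Cmod (x, y)) as Hy.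
  change (Rabs x <= Cmod (x, y)) in Hx. change (Rabs y <= Cmod (x, y)) in Hy.
  apply (H x y); [apply Rabs_le_between; lra | apply Rabs_le_between; lra|].
  intros (u & v & _ & _ & Hu & Hv & Hduv).
  unfold delta in Hu, Hv, Hduv.
  destruct (constructive_indefinite_description _ (Hd u v)) as [k [K1 K2]]. simpl in *.
  assert (Hk : Cmod ((x, y) - (u, v)) < 2 * k).
  { eapply Rle_lt_trans; [apply Cmod_le_sum|].
    change (Rabs (x - u) + Rabs (y - v) < 2 * k). lra. }
  specialize (K1 _ Hk). pose proof (Cmod_ge_0 (f (u, v))) as P.
  assert (1 + Cmod (f (u, v)) <= / d).
  { rewrite <- (Rinv_inv (1 + Cmod (f (u, v)))). apply Rinv_le_contravar; [apply cond_pos | lra]. }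
  pose proof (Cmod_le_minus (f (x, y)) (f (u, v))). lra.
Qed.

Definition locally_Lipschitz (F : C -> C) : Prop :=
  forall M, exists L, 0 < L /\ forall z w, Cmod z <= M -> Cmod w <= M ->
    Cmod (F z - F w) <= L * Cmod (z - w).

(** Cauchy's estimate on unit disks bounds the derivative on bounded sets. *)
Lemma entire_lipschitz F : entire F -> locally_Lipschitz F.
Proof.
  intros HF M.
  destruct (continuous_bounded_disk F (M + 1)) as [A [HA HB]].
  { intros z. eapply der_cont, entire_cder, HF. }
  exists (2 * A). split; [lra|]. intros z w Hz Hw.
  apply (cmvi (fun z => Cmod z <= M) F (C_derive F)); auto.
  - apply gauge_convex_le, Cmod_gauge.
  - intros x _. apply entire_cder, HF.
  - intros x Hx. replace (2 * A) with (2 * A / 1) by field.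
    apply (cauchy_estimate F x _ 2 1); try lra.
    + intros y _. eexists. apply entire_cder, HF.
    + intros y Hy. eapply Rle_trans; [apply Cmod_minus_le|].
      pose proof (Cmod_le_minus y x). pose proof (HB y ltac:(lra)). pose proof (HB x ltac:(lra)).
      lra.
    + apply entire_cder, HF.
Qed.

(** * Complex-time flows *)

(** A solution of the equation with complex time. *)
Definition cflow (F : C -> C) (de : R) (w : C -> C) : Prop :=
  forall s, Cmod s < de -> cder w s (F (w s)).

(** Picard iteration with primitives in place of integrals.  The iterates are holomorphic, with
derivatives given by the previous iterate; the first order expansions of the iterates have a
uniform error, so they pass to the limit. *)
Lemma picard (F : C -> C) (y : C) (A L de : R) :
  entire F -> 0 < A -> 0 < L -> 0 < de -> A * de <= 1 -> L * de <= / 2 ->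
  (forall z, Cmod (z - y) <= 1 -> Cmod (F z) <= A) ->
  (forall z w, Cmod (z - y) <= 1 -> Cmod (w - y) <= 1 -> Cmod (F z - F w) <= L * Cmod (z - w)) ->
  exists w, w (RtoC 0) = y /\ cflow F de w /\
    forall s, Cmod s < de -> Cmod (w s - y) <= A * Cmod s.
Proof.
  intros HF A0 L0 D0 HAd HLd HA HL.
  set (U := fun s => Cmod s < de).
  assert (U0 : U (RtoC 0)) by (unfold U; rewrite Cmod_0; exact D0).
  assert (UC : convex U) by (apply gauge_convex, Cmod_gauge).
  assert (sub0 : forall s, (s - RtoC 0)%C = s) by (intros; ring).
  set (prim := fun g => epsilon (inhabits (fun _ : C => RtoC 0))
    (fun P => forall s, U s -> cder P s (g s))).
  set (wn := nat_rect (fun _ => C -> C) (fun _ => y)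
    (fun _ v s => y + (prim (fun s => F (v s)) s - prim (fun s => F (v s)) (RtoC 0)))%C).
  assert (W0 : forall n, wn n (RtoC 0) = y).
  { intros [|n]; simpl; [reflexivity | ring]. }
  assert (step : forall n, holomorphic_on U (wn n) ->
    forall s, U s -> cder (wn (S n)) s (F (wn n s))).
  { intros n Hn s Hs. simpl.
    eapply der_ext; [reflexivity| |apply der_plus; [apply der_const|
      apply der_minus; [|apply der_const]]].
    2: { apply (epsilon_spec (inhabits (fun _ : C => RtoC 0))
           (fun P => forall s, U s -> cder P s (F (wn n s)))); [|exact Hs].
         apply (primitive_exists Cmod de (fun s => F (wn n s))); [apply Cmod_gauge|].
         intros z Hz. destruct (Hn z Hz) as [l Hl]. eexists.
         apply (der_comp _ (wn n) F); [apply entire_cder, HF | exact Hl]. }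
    simpl. ring. }
  assert (near : forall s, U s -> A * Cmod s <= 1).
  { unfold U. intros s Hs. pose proof (Cmod_ge_0 s). nra. }
  assert (inv : forall n, holomorphic_on U (wn n) /\
     forall s, U s -> Cmod (wn n s - y) <= A * Cmod s).
  { induction n as [|n [IH1 IH2]].
    - split.
      + intros s _. exists (RtoC 0). apply der_const.
      + intros s _. simpl. rewrite Cmod_minus_diag. apply Rmult_le_pos; [lra | apply Cmod_ge_0].
    - split.
      + intros s Hs. eexists. apply step; auto.
      + intros s Hs. rewrite <- (W0 (S n)). rewrite <- (sub0 s) at 2.
        apply (cmvi U _ (fun s => F (wn n s))); auto.
        intros z Hz. apply HA. eapply Rle_trans; [apply IH2|]; auto. }
  assert (ball : forall n s, U s -> Cmod (wn n s - y) <= 1).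
  { intros n s Hs. eapply Rle_trans; [apply inv|]; auto. }
  assert (P2 : forall n, 0 < 2 ^ n) by (intros; apply pow_lt; lra).
  assert (diff : forall n s, U s -> Cmod (wn (S n) s - wn n s) <= 1 / 2 ^ n).
  { induction n as [|n IH]; intros s Hs.
    - change (wn O s) with y. simpl (2 ^ 0). rewrite Rdiv_1_r. apply ball, Hs.
    - assert (E : (wn (S (S n)) s - wn (S n) s =
        (wn (S (S n)) s - wn (S n) s) - (wn (S (S n)) (RtoC 0) - wn (S n) (RtoC 0)))%C).
      { rewrite !W0. ring. }
      rewrite E. eapply Rle_trans.
      + apply (cmvi U (fun s => wn (S (S n)) s - wn (S n) s)%C
          (fun s => F (wn (S n) s) - F (wn n s))%C (L * (1 / 2 ^ n))); auto.
        * intros z Hz. apply der_minus; apply step; auto; apply inv.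
        * intros z Hz. eapply Rle_trans; [apply HL; apply ball, Hz|].
          apply Rmult_le_compat_l; [lra | apply IH, Hz].
      + rewrite sub0. unfold U in Hs. pose proof (Cmod_ge_0 s).
        assert (L * Cmod s <= / 2) by nra.
        replace (1 / 2 ^ S n) with (/ 2 * / 2 ^ n)
          by (simpl; field; apply pow_nonzero; lra).
        replace (L * (1 / 2 ^ n) * Cmod s) with ((L * Cmod s) * / 2 ^ n) by (unfold Rdiv; ring).
        apply Rmult_le_compat_r; [left; apply Rinv_0_lt_compat, P2 | lra]. }
  set (w := fun s => epsilon (inhabits (RtoC 0))
    (fun l => forall n, Cmod (wn n s - l) <= 2 * 1 / 2 ^ n)).
  assert (Hw : forall s, U s -> forall n, Cmod (wn n s - w s) <= 2 * 1 / 2 ^ n).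
  { intros s Hs. apply (epsilon_spec (inhabits (RtoC 0))
      (fun l => forall n, Cmod (wn n s - l) <= 2 * 1 / 2 ^ n)).
    apply geometric_limit. intros n. apply diff, Hs. }
  assert (approx : forall s e, U s -> 0 < e -> exists n,
     forall k, (n <= k)%nat -> Cmod (wn k s - w s) <= e).
  { intros s e Hs He. destruct (pow2_small (2 * 1) e) as [n Hn]; [lra|lra|].
    exists n. intros k Hk. eapply Rle_trans; [apply Hw, Hs|]. left.
    eapply Rle_lt_trans; [|apply Hn]. unfold Rdiv.
    apply Rmult_le_compat_l; [lra|]. apply Rinv_le_contravar; [apply P2|].
    apply Rle_pow; [lra | exact Hk]. }
  assert (lip : forall n s s', U s -> U s' -> Cmod (wn n s' - wn n s) <= A * Cmod (s' - s)).
  { intros [|n] s s' Hs Hs'.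
    - simpl. rewrite Cmod_minus_diag. apply Rmult_le_pos; [lra | apply Cmod_ge_0].
    - apply (cmvi U _ (fun s => F (wn n s))); auto.
      apply step, inv. }
  assert (wnear : forall s, U s -> Cmod (w s - y) <= A * Cmod s).
  { intros s Hs. apply le_epsilon. intros e He. destruct (approx s e Hs He) as [n Hn].
    eapply Rle_trans; [apply (Cmod_tri3 _ (wn n s))|].
    rewrite (Cmod_minus_sym (w s)). pose proof (Hn n (le_n _)).
    pose proof (proj2 (inv n) s Hs). lra. }
  exists w. split; [|split].
  - apply Cmod_minus_0. eapply Rle_trans; [apply wnear, U0|]. rewrite Cmod_0. lra.
  - intros s Hs.
    assert (key : forall s', U s' ->
      Cmod (w s' - w s - F (w s) * (s' - s)) <= L * (A * Cmod (s' - s)) * Cmod (s' - s)).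
    { intros s' Hs'. apply le_epsilon. intros e He.
      pose proof (Cmod_ge_0 (s' - s)) as Q.
      set (k := e / (2 + L * Cmod (s' - s))).
      assert (Q' : 0 <= L * Cmod (s' - s)) by (apply Rmult_le_pos; lra).
      assert (Hk : 0 < k) by (apply Rdiv_lt_0_compat; lra).
      destruct (approx s k Hs Hk) as [n1 H1]. destruct (approx s' k Hs' Hk) as [n2 H2].
      set (n := (n1 + n2)%nat).
      assert (M : Cmod (wn (S n) s' - wn (S n) s - F (wn n s) * (s' - s)) <=
        L * (A * Cmod (s' - s)) * Cmod (s' - s)).
      { replace (wn (S n) s' - wn (S n) s - F (wn n s) * (s' - s))%C with
          ((wn (S n) s' - F (wn n s) * s') - (wn (S n) s - F (wn n s) * s))%C by ring.
        set (V := fun z => U z /\ Cmod (z - s) <= Cmod (s' - s)).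
        apply (cmvi V (fun z => wn (S n) z - F (wn n s) * z)%C
          (fun z => F (wn n z) - F (wn n s))%C).
        - intros p q t [Hp Hp'] [Hq Hq'] Ht. split; [apply UC; auto|].
          apply (cdisk_convex s (Cmod (s' - s)) p q t); auto.
        - split; [exact Hs|]. rewrite Cmod_minus_diag. exact Q.
        - split; [exact Hs' | lra].
        - intros z [Hz _]. apply der_minus; [apply step; auto; apply inv|].
          eapply der_ext; [reflexivity| |apply der_scal, der_id]. ring.
        - intros z [Hz Hz']. eapply Rle_trans; [apply HL; apply ball; auto|].
          apply Rmult_le_compat_l; [lra|]. eapply Rle_trans; [apply lip; auto|].
          apply Rmult_le_compat_l; lra. }
      pose proof (H1 n ltac:(lia)) as a1. pose proof (H1 (S n) ltac:(lia)) as a2.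
      pose proof (H2 (S n) ltac:(lia)) as a3.
      assert (a4 : Cmod (F (wn n s) - F (w s)) <= L * k).
      { eapply Rle_trans; [apply HL; [apply ball, Hs|]|].
        - eapply Rle_trans; [apply wnear, Hs | apply near, Hs].
        - apply Rmult_le_compat_l; lra. }
      replace (w s' - w s - F (w s) * (s' - s))%C with
        ((wn (S n) s' - wn (S n) s - F (wn n s) * (s' - s)) - (wn (S n) s' - w s')
         + (wn (S n) s - w s) + (F (wn n s) - F (w s)) * (s' - s))%C by ring.
      eapply Rle_trans; [apply Cmod_triangle|].
      eapply Rle_trans; [apply Rplus_le_compat_r, Cmod_triangle|].
      eapply Rle_trans; [apply Rplus_le_compat_r, Rplus_le_compat_r, Cmod_minus_le|].
      rewrite (Cmod_mult (F (wn n s) - F (w s))).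
      assert (Cmod (F (wn n s) - F (w s)) * Cmod (s' - s) <= L * k * Cmod (s' - s))
        by (apply Rmult_le_compat_r; lra).
      assert (E : 2 * k + L * k * Cmod (s' - s) = e) by (unfold k; field; lra). lra. }
    intros e He. exists (Rmin (de - Cmod s) (e / (L * A))). split.
    { apply Rmin_glb_lt; [unfold U in Hs; lra|]. apply Rdiv_lt_0_compat; nra. }
    intros s' Hs'. apply Rmin_Rgt_l in Hs' as [B1 B2].
    eapply Rle_trans; [apply key|].
    + unfold U. pose proof (Cmod_le_minus s' s). lra.
    + apply Rmult_le_compat_r; [apply Cmod_ge_0|].
      apply Rmult_gt_compat_l with (r := L * A) in B2; [|nra].
      replace (L * A * (e / (L * A))) with e in B2 by (field; lra). lra.
  - exact wnear.
Qed.

(** The bounds of [F] and of its Lipschitz constant on a slightly larger disk make the radius [de]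
independent of the initial value. *)
Lemma local_flow (F : C -> C) (M : R) : entire F ->
  exists (de A : R) (w : C -> C -> C), 0 < de /\ 0 < A /\
    forall y, Cmod y <= M -> w y (RtoC 0) = y /\ cflow F de (w y) /\
      forall s, Cmod s < de -> Cmod (w y s - y) <= A * Cmod s.
Proof.
  intros HF.
  destruct (continuous_bounded_disk F (M + 1)) as [A [HA HB]].
  { intros z. eapply der_cont, entire_cder, HF. }
  destruct (entire_lipschitz F HF (M + 1)) as [L [HL HL']].
  set (de := Rmin (/ A) (/ (2 * L))).
  assert (IA : 0 < / A) by (apply Rinv_0_lt_compat; lra).
  assert (IL : 0 < / (2 * L)) by (apply Rinv_0_lt_compat; lra).
  assert (Hde : 0 < de) by (apply Rmin_glb_lt; lra).
  assert (ex : forall y, Cmod y <= M -> exists w, w (RtoC 0) = y /\ cflow F de w /\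
    forall s, Cmod s < de -> Cmod (w s - y) <= A * Cmod s).
  { intros y Hy. assert (B : forall z, Cmod (z - y) <= 1 -> Cmod z <= M + 1).
    { intros z Hz. pose proof (Cmod_le_minus z y). lra. }
    apply (picard F y A L de); auto.
    - replace 1 with (A * / A) by (field; lra). apply Rmult_le_compat_l; [lra | apply Rmin_l].
    - replace (/ 2) with (L * / (2 * L)) by (field; lra).
      apply Rmult_le_compat_l; [lra | apply Rmin_r]. }
  exists de, A, (fun y => epsilon (inhabits (fun _ => RtoC 0)) (fun w => w (RtoC 0) = y /\
    cflow F de w /\ forall s, Cmod s < de -> Cmod (w s - y) <= A * Cmod s)).
  split; [exact Hde|]. split; [exact HA|]. intros y Hy.
  apply (epsilon_spec (inhabits (fun _ => RtoC 0)) _ (ex y Hy)).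
Qed.

(** * Uniqueness and stability of bounded solutions *)

Lemma rcont_bounded (v : R -> C) a b : a <= b -> (forall t, a <= t <= b -> rcont v t) ->
  exists M, forall t, a <= t <= b -> Cmod (v t) <= M.
Proof.
  intros Hab Hv. destruct (continuity_ab_maj (fun t => Cmod (v t)) a b Hab) as [m [Hm _]].
  - intros t Ht e He. destruct (Hv t Ht e He) as [d [Hd H]]. exists d. split; [exact Hd|].
    intros s [_ Hs]. simpl in Hs |- *. unfold Rdist in *.
    specialize (H s). rewrite <- RtoC_minus, Cmod_R in H.
    eapply Rle_lt_trans; [|apply H, Hs].
    pose proof (Cmod_le_minus (v s) (v t)). pose proof (Cmod_le_minus (v t) (v s)).
    rewrite (Cmod_minus_sym (v t)) in *. apply Rabs_le. lra.
  - exists (Cmod (v m)). exact Hm.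
Qed.

(** If [d] is the difference of the solutions and [K] bounds the growth rate, then
[Cmod (d t) ^ 2 * exp (- 2 * K * t)] is non-increasing and starts from 0.  The factor [c] lets the
lemma apply along arbitrary paths in complex time and to reversed time. *)
Lemma ode_unique_fwd (F : C -> C) (c : R -> C) (v1 v2 : R -> C) a b k :
  locally_Lipschitz F -> a <= b ->
  (forall t, a <= t <= b -> rder v1 t (c t * F (v1 t))%C) ->
  (forall t, a <= t <= b -> rder v2 t (c t * F (v2 t))%C) ->
  (forall t, a <= t <= b -> Cmod (c t) <= k) ->
  v1 a = v2 a -> v1 b = v2 b.
Proof.
  intros HF Hab H1 H2 Hc E0.
  destruct (rcont_bounded v1 a b Hab) as [M1 B1]; [intros; eapply der_cont; auto|].
  destruct (rcont_bounded v2 a b Hab) as [M2 B2]; [intros; eapply der_cont; auto|].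
  destruct (HF (Rmax M1 M2)) as [L [HL HL']].
  set (d := fun t => (v1 t - v2 t)%C).
  set (d' := fun t => (c t * F (v1 t) - c t * F (v2 t))%C).
  set (K := k * L).
  assert (Hd : forall t, a <= t <= b -> rder d t (d' t)).
  { intros t Ht. apply der_minus; auto. }
  assert (Hd' : forall t, a <= t <= b -> Cmod (d' t) <= K * Cmod (d t)).
  { intros t Ht. unfold d', d, K.
    replace (c t * F (v1 t) - c t * F (v2 t))%C with (c t * (F (v1 t) - F (v2 t)))%C by ring.
    rewrite Cmod_mult, Rmult_assoc.
    apply Rmult_le_compat; [apply Cmod_ge_0 | apply Cmod_ge_0 | auto |].
    apply HL'; [eapply Rle_trans; [apply B1, Ht | apply Rmax_l]
              | eapply Rle_trans; [apply B2, Ht | apply Rmax_r]]. }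
  set (x := fun t => 1 * Re (d t) + 0 * Im (d t)).
  set (y := fun t => 0 * Re (d t) + 1 * Im (d t)).
  set (x' := fun t => 1 * Re (d' t) + 0 * Im (d' t)).
  set (y' := fun t => 0 * Re (d' t) + 1 * Im (d' t)).
  assert (Hx : forall t, a <= t <= b -> is_derive x t (x' t)).
  { intros t Ht. apply rder_linear_form, Hd, Ht. }
  assert (Hy : forall t, a <= t <= b -> is_derive y t (y' t)).
  { intros t Ht. apply rder_linear_form, Hd, Ht. }
  set (g := fun t => (x t * x t + y t * y t) * exp (- 2 * K * t)).
  assert (Hg : forall t, a <= t <= b -> is_derive g t
    ((2 * (x t * x' t + y t * y' t) - 2 * K * (x t * x t + y t * y t)) * exp (- 2 * K * t))).
  { intros t Ht. unfold g. pose proof (Hx t Ht) as X. pose proof (Hy t Ht) as Y.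
    clearbody x y x' y'. auto_derive.
    - repeat split; eexists; eassumption.
    - change (fun x0 : R => x x0) with x. change (fun x0 : R => y x0) with y.
      rewrite (is_derive_unique _ _ _ X), (is_derive_unique _ _ _ Y). ring. }
  destruct (MVT_gen g a b (fun t =>
    (2 * (x t * x' t + y t * y' t) - 2 * K * (x t * x t + y t * y t)) * exp (- 2 * K * t)))
    as [t [Ht E]].
  { rewrite Rmin_left, Rmax_right by lra. intros t Ht. apply Hg. lra. }
  { rewrite Rmin_left, Rmax_right by lra. intros t Ht.
    apply derivable_continuous_pt. eexists. apply is_derive_Reals, Hg, Ht. }
  rewrite Rmin_left, Rmax_right in Ht by lra.
  assert (Ed : forall s, x s * x s + y s * y s = Cmod (d s) ^ 2).
  { intros s. rewrite Cmod2_alt. unfold x, y. ring. }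
  assert (Ga : g a = 0).
  { unfold g. rewrite Ed. unfold d. rewrite E0, Cmod_minus_diag. ring. }
  assert (I : x t * x' t + y t * y' t <= K * (x t * x t + y t * y t)).
  { rewrite Ed.
    replace (x t * x' t + y t * y' t) with (Re (Cconj (d t) * d' t))
      by (unfold x, y, x', y', Re, Im, Cconj, Cmult; simpl; ring).
    eapply Rle_trans; [apply Rle_abs|]. eapply Rle_trans; [apply re_le_Cmod|].
    rewrite Cmod_mult, Cmod_conj. pose proof (Cmod_ge_0 (d t)). specialize (Hd' t Ht). nra. }
  assert (Gb : g b <= 0).
  { assert (g b = g b - g a) as -> by lra. rewrite E.
    pose proof (exp_pos (- 2 * K * t)) as P.
    set (X := exp (- 2 * K * t)) in *.
    assert (0 <= X * (b - a)) by (apply Rmult_le_pos; lra).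
    rewrite Rmult_assoc.
    assert (2 * (x t * x' t + y t * y' t) - 2 * K * (x t * x t + y t * y t) <= 0) by lra. nra. }
  apply Cmod_minus_0. fold (d b). unfold g in Gb. rewrite Ed in Gb.
  pose proof (exp_pos (- 2 * K * b)) as P. pose proof (Cmod_ge_0 (d b)) as Q.
  destruct Q as [Q|Q]; [|lra]. pose proof (pow_lt _ 2 Q). nra.
Qed.

Lemma ode_unique (F : C -> C) (c : R -> C) (v1 v2 : R -> C) s t k :
  locally_Lipschitz F ->
  (forall r, Rmin s t <= r <= Rmax s t -> rder v1 r (c r * F (v1 r))%C) ->
  (forall r, Rmin s t <= r <= Rmax s t -> rder v2 r (c r * F (v2 r))%C) ->
  (forall r, Rmin s t <= r <= Rmax s t -> Cmod (c r) <= k) ->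
  v1 s = v2 s -> v1 t = v2 t.
Proof.
  intros HF H1 H2 Hc E0. destruct (Rle_dec s t) as [Hst|Hst].
  - rewrite Rmin_left, Rmax_right in * by lra.
    eapply (ode_unique_fwd F c v1 v2 s t k); auto.
  - rewrite Rmin_right, Rmax_left in * by lra.
    pose proof (ode_unique_fwd F (fun r => - c (-1 * r + (s + t))%R)%C
      (fun r => v1 (-1 * r + (s + t))) (fun r => v2 (-1 * r + (s + t))) t s k) as H.
    cbv beta in H. replace (-1 * s + (s + t)) with t in H by ring.
    replace (-1 * t + (s + t)) with s in H by ring.
    apply H; auto; try lra.
    + intros r Hr. eapply der_ext; [reflexivity| |apply rder_rescale, H1; lra]. ring.
    + intros r Hr. eapply der_ext; [reflexivity| |apply rder_rescale, H2; lra]. ring.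
    + intros r Hr. rewrite Cmod_opp. apply Hc. lra.
Qed.

(** Restricted to a segment, both flows solve the same equation in real time. *)
Lemma cflow_unique (F : C -> C) (U : C -> Prop) (w1 w2 : C -> C) p q :
  locally_Lipschitz F -> convex U -> U p -> U q ->
  (forall s, U s -> cder w1 s (F (w1 s))) -> (forall s, U s -> cder w2 s (F (w2 s))) ->
  w1 p = w2 p -> w1 q = w2 q.
Proof.
  intros HF HU Hp Hq H1 H2 E.
  rewrite <- (seg_1 p q) at 1. rewrite <- (seg_1 p q) at 2.
  apply (ode_unique F (fun _ => q - p)%C (fun t => w1 (seg p q t)) (fun t => w2 (seg p q t)) 0 1
    (Cmod (q - p))); auto; try (intros; lra).
  - rewrite Rmin_left, Rmax_right by lra. intros r Hr. rewrite Cmult_comm.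
    apply (der_comp RtoC (seg p q) w1); [apply H1; auto | apply rder_seg].
  - rewrite Rmin_left, Rmax_right by lra. intros r Hr. rewrite Cmult_comm.
    apply (der_comp RtoC (seg p q) w2); [apply H2; auto | apply rder_seg].
  - now rewrite !seg_0.
Qed.

Lemma solution_rder F al be phi : solution F al be phi <->
  forall t, between al be t -> rder phi t (F (phi t)).
Proof.
  split; intros H t Ht; apply is_derive_rder, H, Ht.
Qed.

Lemma between_convex al be s t r : between al be s -> between al be t ->
  Rmin s t <= r <= Rmax s t -> between al be r.
Proof.
  intros [H1 H2] [H3 H4] [H5 H6]. split.
  - eapply Rbar_lt_le_trans; [|exact (H5 : Rbar_le (Rmin s t) r)]. unfold Rmin. destruct Rle_dec; assumption.
  - eapply Rbar_le_lt_trans; [exact (H6 : Rbar_le r (Rmax s t))|]. unfold Rmax. destruct Rle_dec; assumption.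
Qed.

Lemma between_open al be t : between al be t ->
  exists r, 0 < r /\ forall s, Rabs (s - t) < r -> between al be s.
Proof.
  intros [H1 H2].
  destruct (open_Rbar_gt al t H1) as [r1 R1]. destruct (open_Rbar_lt be t H2) as [r2 R2].
  exists (Rmin r1 r2). split; [apply Rmin_glb_lt; apply cond_pos|].
  intros s Hs. apply Rmin_Rgt_l in Hs as [A B]. split; [apply R1, A | apply R2, B].
Qed.

(** The two intervals may differ: only the stretch between [t0] and [t] matters. *)
Lemma solution_unique F al be al' be' phi psi t0 t : locally_Lipschitz F ->
  solution F al be phi -> solution F al' be' psi ->
  between al be t0 -> between al' be' t0 -> between al be t -> between al' be' t ->
  phi t0 = psi t0 -> phi t = psi t.
Proof.
  intros HF H1 H2 B0 B0' B B' E. rewrite solution_rder in H1, H2.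
  apply (ode_unique F (fun _ => RtoC 1) phi psi t0 t 1); auto.
  - intros r Hr. rewrite Cmult_1_l. apply H1. exact (between_convex _ _ _ _ _ B0 B Hr).
  - intros r Hr. rewrite Cmult_1_l. apply H2. exact (between_convex _ _ _ _ _ B0' B' Hr).
  - intros. rewrite Cmod_1. lra.
Qed.

(** A primitive [T] of [1 / F] measures complex time: along the segment from [z] to [y], the curve
[w (T x - T z)] satisfies the same differential equation as [x] itself, so [w (T y - T z) = y]. *)
Lemma cflow_cover F z de w : entire F -> F z <> RtoC 0 -> 0 < de -> cflow F de w ->
  w (RtoC 0) = z ->
  exists r, 0 < r /\ forall y, Cmod (y - z) < r -> exists s, Cmod s < de /\ w s = y.
Proof.
  intros HF Fz Hde Hw W0.
  assert (Hm : 0 < Cmod (F z) / 2) by (apply Cmod_gt_0 in Fz; lra).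
  set (m := Cmod (F z) / 2) in *.
  destruct (der_cont _ _ _ _ (entire_cder F HF z) m Hm) as [r0 [R0 Hr0]].
  assert (HFm : forall y, Cmod (y - z) < r0 -> m <= Cmod (F y)).
  { intros y Hy. specialize (Hr0 y Hy). pose proof (Cmod_le_minus (F z) (F y)).
    rewrite Cmod_minus_sym in Hr0. unfold m in *. lra. }
  assert (HF0 : forall y, Cmod (y - z) < r0 -> F y <> RtoC 0).
  { intros y Hy. apply Cmod_gt_0. specialize (HFm y Hy). lra. }
  destruct (primitive_exists (fun y => Cmod (y - z)) r0 (fun y => / F y)%C (disk_gauge z))
    as [T HT].
  { intros y Hy. eexists. apply (der_comp _ F Cinv); [apply cder_inv, HF0, Hy|].
    apply entire_cder, HF. }
  exists (Rmin r0 (m * de)). split; [apply Rmin_glb_lt; nra|].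
  intros y Hy. apply Rmin_Rgt_l in Hy as [Y1 Y2].
  assert (Z0 : Cmod (z - z) < r0) by (rewrite Cmod_minus_diag; exact R0).
  assert (Dinv : forall x, Cmod (x - z) < r0 -> Cmod (/ F x) <= / m).
  { intros x Hx. rewrite Cmod_inv by auto. apply Rinv_le_contravar; auto. }
  assert (Hseg : forall t, 0 <= t <= 1 -> Cmod (seg z y t - z) <= Cmod (y - z)).
  { intros t Ht. apply (cdisk_convex z (Cmod (y - z)) z y t); auto; [|lra].
    rewrite Cmod_minus_diag. apply Cmod_ge_0. }
  assert (HTs : forall x, Cmod (x - z) <= Cmod (y - z) -> Cmod (T x - T z) < de).
  { intros x Hx. eapply Rle_lt_trans.
    - apply (cmvi (fun x => Cmod (x - z) < r0) T (fun x => / F x)%C (/ m)); auto.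
      + apply disk_convex.
      + lra.
    - apply Rmult_lt_reg_l with m; [exact Hm|]. rewrite <- Rmult_assoc, Rinv_r by lra. lra. }
  exists (T y - T z)%C. split; [apply HTs; lra|].
  enough (E : w (T (seg z y 1) - T z)%C = seg z y 1) by (now rewrite seg_1 in E).
  apply (ode_unique F (fun t => (y - z) * / F (seg z y t))%C
    (fun t => w (T (seg z y t) - T z)%C) (seg z y) 0 1 (Cmod (y - z) * / m));
    [apply entire_lipschitz, HF | | | |];
    rewrite ?Rmin_left, ?Rmax_right by lra.
  - intros t Ht. specialize (Hseg t Ht).
    eapply der_ext; [reflexivity| |apply (der_comp RtoC (fun t => T (seg z y t) - T z)%C w)].
    3: { apply der_minus; [|apply der_const]. apply (der_comp RtoC (seg z y) T); [|apply rder_seg].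
         apply HT. lra. }
    2: { apply Hw, HTs, Hseg. }
    simpl. ring.
  - intros t Ht. specialize (Hseg t Ht).
    eapply der_ext; [reflexivity| |apply rder_seg]. field. apply HF0. lra.
  - intros t Ht. specialize (Hseg t Ht). rewrite Cmod_mult.
    apply Rmult_le_compat_l; [apply Cmod_ge_0 | apply Dinv; lra].
  - rewrite seg_0. replace (T z - T z)%C with (RtoC 0) by ring. exact W0.
Qed.

Lemma rder_shift (u : R -> C) (b t : R) l : rder u (t + b) l -> rder (fun t => u (t + b)) t l.
Proof.
  intros H. replace (t + b) with (1 * t + b) in H by ring.
  eapply der_ext; [| |apply (rder_rescale _ _ _ _ _ H)].
  - intros s. simpl. f_equal. ring.
  - ring.
Qed.

Lemma rder_cflow F de w s t : cflow F de w -> Cmod (s + RtoC t) < de ->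
  rder (fun t => w (s + RtoC t)%C) t (F (w (s + RtoC t)%C)).
Proof.
  intros Hw Hs. eapply der_ext; [reflexivity| |apply (der_comp RtoC (fun t => s + RtoC t)%C w)].
  3: { apply der_plus; [apply der_const | apply der_id]. }
  2: { apply Hw, Hs. }
  simpl. ring.
Qed.

(** Near [t0] one has [gam t = w (gam t0) (t - t0)], and by uniqueness in complex time
[w (gam t) s = w (gam t0) (s + (t - t0))], which solves the equation in [t]. *)
Lemma flow_commutes F M de (w : C -> C -> C) al be gam s : entire F ->
  (forall y, Cmod y <= M -> w y (RtoC 0) = y /\ cflow F de (w y)) ->
  solution F al be gam -> (forall t, between al be t -> Cmod (gam t) <= M) -> Cmod s < de ->
  solution F al be (fun t => w (gam t) s).
Proof.
  intros HF Hw Hg HM Hs. apply solution_rder. intros t0 Ht0.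
  assert (HL := entire_lipschitz F HF).
  destruct (between_open _ _ _ Ht0) as [r [R0 Hr]].
  set (rho := Rmin r (de - Cmod s)).
  assert (Hrho : 0 < rho) by (apply Rmin_glb_lt; lra).
  destruct (Hw _ (HM _ Ht0)) as [w0 w1].
  assert (near : forall t, Rabs (t - t0) < rho ->
     between al be t /\ Rabs (t - t0) < de - Cmod s).
  { intros t Ht. apply Rmin_Rgt_l in Ht as [A B]. auto. }
  pose proof (Cmod_ge_0 s) as S0.
  assert (E1 : forall t, Rabs (t - t0) < rho -> gam t = w (gam t0) (RtoC (t - t0))).
  { intros t Ht.
    set (om := fun t => w (gam t0) (- RtoC t0 + RtoC t)%C).
    assert (om t = w (gam t0) (RtoC (t - t0))) as <-.
    { unfold om. f_equal. rewrite RtoC_minus. ring. }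
    assert (B0 : between (t0 - rho) (t0 + rho) t0) by (split; simpl; lra).
    assert (B : between (t0 - rho) (t0 + rho) t).
    { apply Rabs_lt_between in Ht. split; simpl; lra. }
    apply (solution_unique F al be (t0 - rho) (t0 + rho) gam om t0 t HL Hg); auto.
    - apply solution_rder. intros x [X1 X2]. simpl in X1, X2. apply (rder_cflow F de); [exact w1|].
      replace (- RtoC t0 + RtoC x)%C with (RtoC (x - t0)) by (rewrite RtoC_minus; ring).
      rewrite Cmod_R. assert (Hx : Rabs (x - t0) < rho) by (apply Rabs_lt_between; lra).
      apply near in Hx. lra.
    - apply near, Ht.
    - unfold om. replace (- RtoC t0 + RtoC t0)%C with (RtoC 0) by ring. now rewrite w0. }
  assert (E2 : forall t, Rabs (t - t0) < rho ->
    w (gam t0) ((s - RtoC t0) + RtoC t)%C = w (gam t) s).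
  { intros t Ht. destruct (near t Ht) as [Bt Dt].
    destruct (Hw _ (HM _ Bt)) as [u0 u1]. symmetry.
    set (h := RtoC (t - t0)).
    assert (Ch : Cmod h < de - Cmod s) by (unfold h; rewrite Cmod_R; exact Dt).
    replace ((s - RtoC t0) + RtoC t)%C with (s + h)%C by (unfold h; rewrite RtoC_minus; ring).
    apply (cflow_unique F (fun x => Cmod x < de /\ Cmod (x + h) < de) (w (gam t))
      (fun x => w (gam t0) (x + h)%C) (RtoC 0) s HL).
    - intros p q x [P1 P2] [Q1 Q2] Hx. split.
      + apply (gauge_convex Cmod de Cmod_gauge p q x); auto.
      + replace (seg p q x + h)%C with (seg (p + h) (q + h) x) by (unfold seg; ring).
        apply (gauge_convex Cmod de Cmod_gauge); auto.
    - rewrite Cmod_0, Cplus_0_l. lra.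
    - split; [exact Hs|]. pose proof (Cmod_triangle s h). lra.
    - intros x [X1 _]. apply u1, X1.
    - intros x [_ X2]. eapply der_ext; [reflexivity| |
        apply (der_comp _ (fun x => x + h)%C (w (gam t0)))].
      3: { apply der_plus; [apply der_id | apply der_const]. }
      2: { apply w1, X2. }
      simpl. ring.
    - rewrite u0, Cplus_0_l. apply E1, Ht. }
  apply (der_ext_loc RtoC (fun t => w (gam t0) ((s - RtoC t0) + RtoC t)%C) _ _ _ rho Hrho).
  - intros t Ht. rewrite <- RtoC_minus, Cmod_R in Ht. apply E2, Ht.
  - rewrite <- (E2 t0) by (rewrite Rminus_diag, Rabs_R0; exact Hrho).
    apply (rder_cflow F de); [exact w1|].
    replace (s - RtoC t0 + RtoC t0)%C with s by ring. exact Hs.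
Qed.

(** Move the whole curve [gam] by one complex time [s], chosen so that [gam 0] goes to [y]. *)
Theorem bounded_stability F M al be gam e : entire F -> solution F al be gam ->
  (forall t, between al be t -> Cmod (gam t) <= M) -> between al be 0 ->
  F (gam 0) <> RtoC 0 -> 0 < e ->
  exists r, 0 < r /\ forall y, Cmod (y - gam 0) < r ->
    exists eta, eta 0 = y /\ solution F al be eta /\
      forall t, between al be t -> Cmod (eta t - gam t) <= e.
Proof.
  intros HF Hg HM H0 Hn He.
  destruct (local_flow F M HF) as (de & A & w & Hde & HA & Hw).
  set (k := Rmin de (e / A)).
  assert (Hk : 0 < k) by (apply Rmin_glb_lt; [lra | apply Rdiv_lt_0_compat; lra]).
  destruct (Hw _ (HM _ H0)) as (w0 & w1 & _).
  destruct (cflow_cover F (gam 0) k (w (gam 0))) as [r [Hr Hr']]; auto.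
  { intros s Hs. apply w1. eapply Rlt_le_trans; [apply Hs | apply Rmin_l]. }
  exists r. split; [exact Hr|]. intros y Hy. destruct (Hr' y Hy) as [s [Hs Es]].
  apply Rmin_Rgt_l in Hs as [S1 S2].
  exists (fun t => w (gam t) s). split; [exact Es|]. split.
  - apply (flow_commutes F M de); auto. intros z Hz. destruct (Hw z Hz) as (a1 & a2 & _). auto.
  - intros t Ht. destruct (Hw _ (HM _ Ht)) as (_ & _ & a). eapply Rle_trans; [apply a, S1|].
    apply Rmult_gt_compat_l with (r := A) in S2; [|lra].
    replace (A * (e / A)) with e in S2 by (field; lra). lra.
Qed.

(** * Maximal solutions and convergence to a point *)

Lemma Rbar_dense (x y : Rbar) : Rbar_lt x y -> exists t : R, Rbar_lt x t /\ Rbar_lt t y.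
Proof.
  destruct x as [x| |], y as [y| |]; simpl; try tauto; intros H.
  - exists ((x + y) / 2). lra.
  - exists (x + 1). split; [lra | exact I].
  - exists (y - 1). split; [exact I | lra].
  - exists 0. split; exact I.
Qed.

Lemma solution_restrict F al be al' be' phi : Rbar_le al al' -> Rbar_le be' be ->
  solution F al be phi -> solution F al' be' phi.
Proof.
  intros H1 H2 H t [T1 T2]. apply H. split.
  - eapply Rbar_le_lt_trans; eassumption.
  - eapply Rbar_lt_le_trans; eassumption.
Qed.

(** By uniqueness the two solutions agree on the overlap, so they define a single curve. *)
Lemma solution_glue F al be al' be' a b phi psi t0 : locally_Lipschitz F ->
  solution F al be phi -> solution F al' be' psi ->
  between al be t0 -> between al' be' t0 -> phi t0 = psi t0 ->
  (forall t, between a b t -> between al be t \/ between al' be' t) ->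
  exists theta, solution F a b theta /\
    (forall t, between al be t -> theta t = phi t) /\
    (forall t, between al' be' t -> theta t = psi t).
Proof.
  intros HF H1 H2 B0 B0' E HU.
  set (theta := fun t => if excluded_middle_informative (between al be t) then phi t else psi t).
  assert (Ephi : forall t, between al be t -> theta t = phi t).
  { intros t Ht. unfold theta. destruct excluded_middle_informative; tauto. }
  assert (Epsi : forall t, between al' be' t -> theta t = psi t).
  { intros t Ht. unfold theta. destruct excluded_middle_informative as [i|]; [|reflexivity].
    apply (solution_unique F al be al' be' phi psi t0 t); auto. }
  exists theta. split; [|auto]. apply solution_rder. rewrite solution_rder in H1, H2.
  intros t Ht. destruct (HU t Ht) as [B|B]; destruct (between_open _ _ _ B) as [r [R0 Hr]].
  - rewrite (Ephi t B). apply (der_ext_loc RtoC phi _ _ _ r R0); [|auto].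
    intros s Hs. rewrite <- RtoC_minus, Cmod_R in Hs. symmetry. auto.
  - rewrite (Epsi t B). apply (der_ext_loc RtoC psi _ _ _ r R0); [|auto].
    intros s Hs. rewrite <- RtoC_minus, Cmod_R in Hs. symmetry. auto.
Qed.

(** Otherwise gluing would extend the maximal solution. *)
Lemma maximal_covers F x al be phi a b psi t0 : locally_Lipschitz F ->
  maximal_solution F x al be phi -> solution F a b psi ->
  between al be t0 -> between a b t0 -> phi t0 = psi t0 ->
  Rbar_le al a /\ Rbar_le b be /\ forall t, between a b t -> phi t = psi t.
Proof.
  intros HF (M0 & Mx & Ms & Mm) Hpsi B0 B0' E.
  assert (H1 : Rbar_le al a).
  { apply Rbar_not_lt_le. intros Hlt.
    destruct (solution_glue F al be a b a be phi psi t0) as (th & T1 & T2 & T3); auto.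
    - intros t [X1 X2]. destruct (Rlt_dec t t0) as [Hl|Hl].
      + right. split; [exact X1|]. eapply Rbar_lt_trans; [|apply B0']. exact Hl.
      + left. split; [|exact X2]. eapply Rbar_lt_le_trans; [apply B0|]. simpl. lra.
    - destruct (Mm a be th) as [Q _]; auto.
      + apply Rbar_lt_le, Hlt.
      + apply Rbar_le_refl.
      + subst a. exact (Rbar_lt_not_eq _ _ Hlt eq_refl). }
  assert (H2 : Rbar_le b be).
  { apply Rbar_not_lt_le. intros Hlt.
    destruct (solution_glue F al be a b al b phi psi t0) as (th & T1 & T2 & T3); auto.
    - intros t [X1 X2]. destruct (Rlt_dec t t0) as [Hl|Hl].
      + left. split; [exact X1|]. eapply Rbar_lt_trans; [|apply B0]. exact Hl.
      + right. split; [|exact X2]. eapply Rbar_lt_le_trans; [apply B0'|]. simpl. lra.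
    - destruct (Mm al b th) as [_ Q]; auto.
      + apply Rbar_le_refl.
      + apply Rbar_lt_le, Hlt.
      + subst b. exact (Rbar_lt_not_eq _ _ Hlt eq_refl). }
  split; [exact H1|]. split; [exact H2|]. intros t Ht.
  apply (solution_unique F al be a b phi psi t0 t); auto. destruct Ht as [T1 T2]. split.
  - eapply Rbar_le_lt_trans; eassumption.
  - eapply Rbar_lt_le_trans; eassumption.
Qed.

Lemma local_solution F M : entire F -> exists de, 0 < de /\ forall y t0, Cmod y <= M ->
  exists psi, psi t0 = y /\ solution F (t0 - de) (t0 + de) psi.
Proof.
  intros HF. destruct (local_flow F M HF) as (de & A & w & Hde & _ & Hw).
  exists de. split; [exact Hde|]. intros y t0 Hy. destruct (Hw y Hy) as (w0 & w1 & _).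
  exists (fun t => w y (- RtoC t0 + RtoC t)%C). split.
  - replace (- RtoC t0 + RtoC t0)%C with (RtoC 0) by ring. exact w0.
  - apply solution_rder. intros t [T1 T2]. simpl in T1, T2. apply (rder_cflow F de); [exact w1|].
    replace (- RtoC t0 + RtoC t)%C with (RtoC (t - t0)) by (rewrite RtoC_minus; ring).
    rewrite Cmod_R. apply Rabs_lt_between. lra.
Qed.

(** Any two solutions through [x] agree where both are defined, so all of them together define one
solution on the union of their intervals. *)
Lemma maximal_exists F x : entire F -> exists al be phi, maximal_solution F x al be phi.
Proof.
  intros HF. assert (HL := entire_lipschitz F HF).
  set (W := fun (t : R) (a b : Rbar) (psi : R -> C) =>
    between a b 0 /\ between a b t /\ solution F a b psi /\ psi 0 = x).
  set (E := fun t => exists a b psi, W t a b psi).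
  set (phi := fun t => epsilon (inhabits x) (fun v => exists a b psi, W t a b psi /\ v = psi t)).
  assert (Hphi : forall t a b psi, W t a b psi -> phi t = psi t).
  { intros t a b psi Hw. unfold phi.
    destruct (epsilon_spec (inhabits x) (fun v => exists a b psi, W t a b psi /\ v = psi t))
      as (a' & b' & psi' & (W1 & W2 & W3 & W4) & ->); [exists (psi t), a, b, psi; auto|].
    destruct Hw as (V1 & V2 & V3 & V4).
    apply (solution_unique F a' b' a b psi' psi 0 t); auto. congruence. }
  assert (E0 : E 0).
  { destruct (local_solution F (Cmod x) HF) as [de [Hde H]].
    destruct (H x 0 (Rle_refl _)) as [psi [P1 P2]].
    assert (B : between (0 - de) (0 + de) 0) by (split; simpl; lra).
    exists (0 - de), (0 + de), psi. split; [|split; [|split]]; auto. }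
  set (be := Lub_Rbar E). set (al := Glb_Rbar E).
  destruct (Lub_Rbar_correct E) as [U1 U2]. destruct (Glb_Rbar_correct E) as [G1 G2].
  fold be in U1, U2. fold al in G1, G2.
  assert (EB : forall t, E t -> between al be t).
  { intros t (a & b & psi & W1 & W2 & W3 & W4). destruct (between_open _ _ _ W2) as [r [R0 Hr]].
    assert (Ep : forall s, Rabs (s - t) < r -> E s).
    { intros s Hs. exists a, b, psi. split; [|split; [|split]]; auto. }
    split.
    - apply (Rbar_le_lt_trans _ (t - r / 2)); [|simpl; lra]. apply G1, Ep.
      apply Rabs_lt_between. lra.
    - apply (Rbar_lt_le_trans _ (t + r / 2)); [simpl; lra|]. apply U1, Ep.
      apply Rabs_lt_between. lra. }
  assert (BE : forall t, between al be t -> E t).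
  { intros t [T1 T2]. destruct (Rle_dec 0 t) as [Ht|Ht].
    - assert (H : exists s, E s /\ t < s).
      { apply NNPP. intros Hn. apply (Rbar_lt_not_le _ _ T2). apply U2. intros s Hs. simpl.
        apply Rnot_lt_le. intros Hlt. apply Hn. eauto. }
      destruct H as (s & (a & b & psi & W1 & W2 & W3 & W4) & Hs).
      exists a, b, psi. split; [|split; [|split]]; auto.
      apply (between_convex _ _ _ _ _ W1 W2); rewrite Rmin_left, Rmax_right; lra.
    - assert (H : exists s, E s /\ s < t).
      { apply NNPP. intros Hn. apply (Rbar_lt_not_le _ _ T1). apply G2. intros s Hs. simpl.
        apply Rnot_lt_le. intros Hlt. apply Hn. eauto. }
      destruct H as (s & (a & b & psi & W1 & W2 & W3 & W4) & Hs).
      exists a, b, psi. split; [|split; [|split]]; auto.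
      apply (between_convex _ _ _ _ _ W1 W2); rewrite Rmin_right, Rmax_left; lra. }
  exists al, be, phi. split; [|split; [|split]].
  - apply EB, E0.
  - destruct E0 as (a & b & psi & Hw). rewrite (Hphi _ _ _ _ Hw). apply Hw.
  - apply solution_rder. intros t Ht. destruct (BE t Ht) as (a & b & psi & Hw).
    rewrite (Hphi _ _ _ _ Hw). destruct Hw as (W1 & W2 & W3 & W4).
    destruct (between_open _ _ _ W2) as [r [R0 Hr]].
    apply (der_ext_loc RtoC psi _ _ _ r R0); [|rewrite solution_rder in W3; auto].
    intros s Hs. rewrite <- RtoC_minus, Cmod_R in Hs. symmetry. apply (Hphi s a b).
    split; [|split; [|split]]; auto.
  - intros al' be' psi A1 A2 Hpsi Hext.
    assert (B0 : between al be 0) by apply EB, E0.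
    assert (B0' : between al' be' 0).
    { destruct B0. split; [eapply Rbar_le_lt_trans | eapply Rbar_lt_le_trans]; eassumption. }
    assert (P0 : psi 0 = x).
    { rewrite Hext by exact B0. destruct E0 as (a & b & psi' & Hw).
      rewrite (Hphi _ _ _ _ Hw). apply Hw. }
    assert (Hin : forall t, between al' be' t -> between al be t).
    { intros t Ht. apply EB. exists al', be', psi. split; [|split; [|split]]; auto. }
    split; apply Rbar_le_antisym; auto; apply Rbar_not_lt_le; intros Hlt;
      destruct (Rbar_dense _ _ Hlt) as [t [T1 T2]].
    + apply (Rbar_lt_not_le _ _ T2), Rbar_lt_le, Hin. split; [exact T1|].
      eapply Rbar_lt_trans; [apply T2|]. eapply Rbar_lt_trans; [apply B0 | apply B0'].
    + apply (Rbar_lt_not_le _ _ T1), Rbar_lt_le, Hin. split; [|exact T2].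
      eapply Rbar_lt_trans; [|apply T1]. eapply Rbar_lt_trans; [apply B0' | apply B0].
Qed.

(** On a bounded set the existence time [de] is uniform, so a solution reaching a time less than [de]
before a finite end point could be continued past it. *)
Lemma bounded_maximal_global F x al be phi M T : entire F ->
  maximal_solution F x al be phi -> between al be T ->
  (forall t, T <= t -> between al be t -> Cmod (phi t) <= M) -> be = p_infty.
Proof.
  intros HF Hm HT HM. destruct be as [b| |]; [|reflexivity|].
  2: { destruct HT as [_ []]. }
  exfalso. destruct (local_solution F M HF) as [de [Hde H]].
  set (t1 := Rmax T (b - de / 2)).
  assert (Bt : between al b t1).
  { destruct HT as [T1 T2]. split.
    - eapply Rbar_lt_le_trans; [apply T1|]. apply Rmax_l.
    - simpl in *. unfold t1. apply Rmax_lub_lt; lra. }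
  destruct (H (phi t1) t1) as [psi [P1 P2]]; [apply HM; [apply Rmax_l | exact Bt]|].
  destruct (maximal_covers F x al b phi _ _ psi t1 (entire_lipschitz F HF) Hm P2 Bt)
    as (_ & Q & _); auto.
  - split; simpl; lra.
  - simpl in Q. pose proof (Rmax_r T (b - de / 2)). unfold t1 in Q. lra.
Qed.

Lemma locally_Cmod (z : C) (P : C -> Prop) :
  locally (T := C_UniformSpace) z P <->
  exists r, 0 < r /\ forall y, Cmod (y - z) < r -> P y.
Proof.
  split.
  - intros [e H]. exists e. split; [apply cond_pos|]. intros y Hy. apply H.
    now apply C_NormedModule_mixin_compat1.
  - intros (r & Hr & H). assert (Hr2 : 0 < r / 2) by lra. exists (mkposreal _ Hr2).
    intros y Hy. apply H. apply C_NormedModule_mixin_compat2 in Hy. simpl in Hy.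
    eapply Rlt_le_trans; [apply Hy|].
    assert (sqrt 2 <= 2) by (pose proof sqrt2_neq_0; pose proof (Rlt_sqrt2_0);
      pose proof (sqrt_sqrt 2 ltac:(lra)); nra). nra.
Qed.

(** Stated with any solution defined for all later times, instead of the maximal one, so that gluing,
shifting and restricting solutions give convergence directly. *)
Definition converges (F : C -> C) (a x : C) : Prop :=
  exists (e : R) (phi : R -> C), 0 < e /\ solution F (- e) p_infty phi /\ phi 0 = x /\
    forall d, 0 < d -> exists T, forall t, T <= t -> Cmod (phi t - a) < d.

Lemma solution_shift_infty F (al b : R) phi : solution F al p_infty phi ->
  solution F (al - b) p_infty (fun t => phi (t + b)).
Proof.
  rewrite !solution_rder. intros H t [T1 T2]. simpl in T1, T2. apply rder_shift, H.
  split; simpl; [lra | exact I].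
Qed.

(** Glue the solution tending to [a] to [phi] and shift time. *)
Lemma converges_invariant F a al be phi t0 t1 : locally_Lipschitz F ->
  solution F al be phi -> between al be t0 -> between al be t1 ->
  converges F a (phi t0) -> converges F a (phi t1).
Proof.
  intros HF Hphi B0 B1 (e & psi & He & Hpsi & P0 & Hlim).
  set (chi := fun t => psi (t + - t0)).
  assert (Hchi : solution F (- e - - t0) p_infty chi) by apply solution_shift_infty, Hpsi.
  destruct (Rbar_dense al (Rmin t0 t1)) as [m [M1 M2]].
  { unfold Rmin. destruct Rle_dec; [apply B0 | apply B1]. }
  simpl in M2. pose proof (Rmin_l t0 t1). pose proof (Rmin_r t0 t1).
  destruct (solution_glue F al be (- e - - t0) p_infty m p_infty phi chi t0) as (th & T1 & T2 & T3);
    auto.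
  - split; simpl; [lra | exact I].
  - unfold chi. rewrite Rplus_opp_r. auto.
  - intros t [X1 X2]. simpl in X1. destruct (Rlt_dec t t0) as [Hl|Hl].
    + left. split.
      * eapply Rbar_lt_trans; [apply M1 | exact X1].
      * eapply Rbar_lt_trans; [|apply B0]. exact Hl.
    + right. split; simpl; [lra | exact I].
  - exists (t1 - m), (fun t => th (t + t1)). split; [lra|]. split; [|split].
    + replace (- (t1 - m)) with (m - t1) by ring. apply solution_shift_infty, T1.
    + rewrite Rplus_0_l. apply T2, B1.
    + intros d Hd. destruct (Hlim d Hd) as [T HT]. exists (Rmax (T + t0 - t1) (t0 - t1)).
      intros t Ht. pose proof (Rmax_l (T + t0 - t1) (t0 - t1)).
      pose proof (Rmax_r (T + t0 - t1) (t0 - t1)).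
      rewrite T3 by (split; simpl; [lra | exact I]). apply HT. lra.
Qed.

(** A finite right end point is impossible, because the solution is bounded near it. *)
Lemma tends_converges F a x : entire F -> tends_to_forward F x a -> converges F a x.
Proof.
  intros HF (al & be & phi & Hm & Hlim).
  assert (Hl : forall d, 0 < d ->
    Rbar_locally be (fun t => between al be t -> Cmod (phi t - a) < d)).
  { intros d Hd. apply (Hlim (fun y => Cmod (y - a) < d)). apply locally_Cmod. exists d. auto. }
  pose proof Hm as (B0 & P0 & Hs & _).
  assert (Hbe : be = p_infty).
  { destruct be as [b| |]; [|reflexivity|]. 2: { destruct B0 as [_ []]. }
    destruct (Hl 1 Rlt_0_1) as [[e He] H]. simpl in H.
    apply (bounded_maximal_global F x al b phi (Cmod a + 1) (Rmax 0 (b - e / 2)) HF Hm).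
    - destruct B0 as [X1 X2]. split.
      + eapply Rbar_lt_le_trans; [apply X1|]. apply Rmax_l.
      + simpl in *. apply Rmax_lub_lt; lra.
    - intros t Ht Bt. pose proof (Rmax_r 0 (b - e / 2)).
      assert (Cmod (phi t - a) < 1).
      { apply H; [|exact Bt]. destruct Bt as [_ Bt]. simpl in Bt.
        change (Rabs (t - b) < e). apply Rabs_lt_between. lra. }
      pose proof (Cmod_le_minus (phi t) a). lra. }
  subst be. destruct (between_open _ _ _ B0) as [r [R0 Hr]].
  exists (r / 2), phi. split; [lra|]. split; [|split; [exact P0|]].
  - apply (solution_restrict F al p_infty); auto; [|apply Rbar_le_refl].
    apply Rbar_lt_le. apply (Hr (- (r / 2))). rewrite Rminus_0_r, Rabs_Ropp, Rabs_pos_eq; lra.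
  - intros d Hd. destruct (Hl d Hd) as [T HT]. exists (Rmax T 0 + 1). intros t Ht.
    pose proof (Rmax_l T 0). pose proof (Rmax_r T 0). apply HT; [lra|]. split; [|exact I].
    eapply Rbar_lt_trans; [apply B0|]. simpl. lra.
Qed.

Lemma converges_maximal F a x al be phi : locally_Lipschitz F ->
  maximal_solution F x al be phi -> converges F a x ->
  be = p_infty /\ forall d, 0 < d -> exists T, forall t, T <= t -> Cmod (phi t - a) < d.
Proof.
  intros HF Hm (e & psi & He & Hpsi & P0 & Hlim).
  pose proof Hm as (B0 & Mx & _).
  destruct (maximal_covers F x al be phi (- e) p_infty psi 0 HF Hm Hpsi B0) as (_ & Q & Hext).
  { split; simpl; [lra | exact I]. }
  { congruence. }
  split; [destruct be; simpl in Q; tauto|].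
  intros d Hd. destruct (Hlim d Hd) as [T HT]. exists (Rmax T 0). intros t Ht.
  pose proof (Rmax_l T 0). pose proof (Rmax_r T 0).
  rewrite Hext by (split; simpl; [lra | exact I]). apply HT. lra.
Qed.

(** As soon as the orbit comes near the limit point [a], attraction takes over. *)
Lemma omega_limit_iff F a x : entire F -> attracting F a ->
  (forall y, w_plus F x y <-> y = a) <-> converges F a x.
Proof.
  intros HF Ha. assert (HL := entire_lipschitz F HF). split.
  - intros H. destruct (proj2 (H a) eq_refl) as (al & be & phi & Hm & u & U1 & U2 & U3).
    apply locally_Cmod in Ha as (r & Hr & Ha).
    assert (V : locally (T := C_UniformSpace) a (fun y => Cmod (y - a) < r))
      by (apply locally_Cmod; eauto).
    destruct (U3 _ V) as [N HN]. specialize (HN N (le_n _)).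
    destruct Hm as (B0 & <- & Hs & _).
    apply (converges_invariant F a al be phi (u N) 0); auto. apply tends_converges; auto.
  - intros Hc y. split.
    + intros (al & be & phi & Hm & u & U1 & U2 & U3).
      destruct (converges_maximal F a x al be phi HL Hm Hc) as [-> Hlim].
      apply Cmod_minus_0. apply le_epsilon. intros d Hd.
      destruct (Hlim (d / 2)) as [T HT]; [lra|].
      assert (V : locally (T := C_UniformSpace) y (fun z => Cmod (z - y) < d / 2))
        by (apply locally_Cmod; exists (d / 2); split; [lra | auto]).
      destruct (U3 _ V) as [N1 H1].
      apply is_lim_seq_spec in U2. destruct (U2 T) as [N2 H2].
      set (n := (N1 + N2)%nat). specialize (H1 n ltac:(lia)). specialize (H2 n ltac:(lia)).
      specialize (HT (u n) ltac:(lra)).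
      eapply Rle_trans; [apply (Cmod_tri3 _ (phi (u n)))|].
      rewrite (Cmod_minus_sym y). lra.
    + intros ->. destruct (maximal_exists F x HF) as (al & be & phi & Hm).
      destruct (converges_maximal F a x al be phi HL Hm Hc) as [-> Hlim].
      exists al, p_infty, phi. split; [exact Hm|]. exists INR. split; [|split].
      * intros n. destruct Hm as ([B _] & _). split; [|exact I].
        eapply Rbar_lt_le_trans; [apply B|]. apply pos_INR.
      * apply is_lim_seq_INR.
      * intros P HP. apply locally_Cmod in HP as (r & Hr & HP).
        destruct (Hlim r Hr) as [T HT]. pose proof is_lim_seq_INR as HI.
        apply is_lim_seq_spec in HI. destruct (HI T) as [N HN]. exists N. intros n Hn.
        apply HP, HT. left. auto.
Qed.

(** * Basins *)

Definition reverse (F : C -> C) (z : C) : C := (- F z)%C.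

Lemma reverse_entire F : entire F -> entire (reverse F).
Proof. intros H z. apply (ex_derive_opp (V := C_NormedModule) F), H. Qed.

Lemma between_opp al be t : between al be t -> between (Rbar_opp be) (Rbar_opp al) (- t).
Proof.
  intros [H1 H2]. split; change (Finite (- t)) with (Rbar_opp t); now apply Rbar_opp_lt.
Qed.

Lemma between_opp_inv al be t : between (Rbar_opp be) (Rbar_opp al) t -> between al be (- t).
Proof.
  intros H. apply between_opp in H. now rewrite !Rbar_opp_involutive in H.
Qed.

Lemma solution_reverse F G al be phi : (forall z, G z = (- F z)%C) -> solution F al be phi ->
  solution G (Rbar_opp be) (Rbar_opp al) (fun t => phi (- t)).
Proof.
  rewrite !solution_rder. intros HG H t Ht. apply between_opp_inv, H in Ht.
  replace (- t) with (-1 * t + 0) in Ht by ring.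
  eapply der_ext; [| |apply (rder_rescale _ _ _ _ _ Ht)].
  - intros s. simpl. f_equal. ring.
  - rewrite HG. replace (-1 * t + 0) with (- t) by ring. ring.
Qed.

Lemma Rbar_opp_le_rev x y : Rbar_le x (Rbar_opp y) -> Rbar_le y (Rbar_opp x).
Proof. intros H. apply Rbar_opp_le. now rewrite Rbar_opp_involutive. Qed.

Lemma Rbar_opp_le_rev' x y : Rbar_le (Rbar_opp x) y -> Rbar_le (Rbar_opp y) x.
Proof. intros H. apply Rbar_opp_le. now rewrite Rbar_opp_involutive. Qed.

Lemma maximal_reverse F G x al be phi : (forall z, G z = (- F z)%C) ->
  maximal_solution F x al be phi ->
  maximal_solution G x (Rbar_opp be) (Rbar_opp al) (fun t => phi (- t)).
Proof.
  intros HG (B0 & P0 & Hs & Hm). split; [|split; [|split]].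
  - rewrite <- Ropp_0. now apply between_opp.
  - now rewrite Ropp_0.
  - now apply (solution_reverse F).
  - intros al' be' psi A1 A2 Hpsi Hext.
    destruct (Hm (Rbar_opp be') (Rbar_opp al') (fun t => psi (- t))) as [Q1 Q2].
    + now apply Rbar_opp_le_rev'.
    + now apply Rbar_opp_le_rev.
    + apply (solution_reverse G); [|exact Hpsi]. intros z. rewrite HG. ring.
    + intros t Ht. rewrite Hext by now apply between_opp. f_equal. ring.
    + rewrite <- Q1, <- Q2. now rewrite !Rbar_opp_involutive.
Qed.

Lemma tends_backward_reverse F a x : tends_to_backward F x a -> tends_to_forward (reverse F) x a.
Proof.
  intros (al & be & phi & Hm & Hlim). exists (Rbar_opp be), (Rbar_opp al), (fun t => phi (- t)).
  split; [now apply (maximal_reverse F)|].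
  intros P HP. specialize (Hlim P HP). unfold filtermap, within in *.
  assert (Hf : filterlim Ropp (Rbar_locally (Rbar_opp al)) (Rbar_locally al)).
  { rewrite <- (Rbar_opp_involutive al) at 2. apply filterlim_Rbar_opp. }
  specialize (Hf _ Hlim). unfold filtermap in Hf. revert Hf.
  apply filter_imp. intros t Ht Bt. apply Ht, between_opp_inv, Bt.
Qed.

Lemma w_minus_reverse F G x y : (forall z, G z = (- F z)%C) -> w_minus F x y -> w_plus G x y.
Proof.
  intros HG (al & be & phi & Hm & u & U1 & U2 & U3).
  exists (Rbar_opp be), (Rbar_opp al), (fun t => phi (- t)).
  split; [now apply (maximal_reverse F)|]. exists (fun n => - u n). split; [|split].
  - intros n. apply between_opp, U1.
  - now apply is_lim_seq_opp in U2.
  - eapply filterlim_ext; [|apply U3]. intros n. simpl. now rewrite Ropp_involutive.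
Qed.

Lemma w_plus_reverse F G x y : (forall z, G z = (- F z)%C) -> w_plus F x y -> w_minus G x y.
Proof.
  intros HG (al & be & phi & Hm & u & U1 & U2 & U3).
  exists (Rbar_opp be), (Rbar_opp al), (fun t => phi (- t)).
  split; [now apply (maximal_reverse F)|]. exists (fun n => - u n). split; [|split].
  - intros n. apply between_opp, U1.
  - now apply is_lim_seq_opp in U2.
  - eapply filterlim_ext; [|apply U3]. intros n. simpl. now rewrite Ropp_involutive.
Qed.

Lemma attracting_reverse F a : repelling F a -> attracting (reverse F) a.
Proof.
  intros H. apply locally_Cmod in H as (r & Hr & H). apply locally_Cmod.
  exists r. split; [exact Hr|]. intros y Hy. apply tends_backward_reverse, H, Hy.
Qed.

(** Time reversal turns negative limit sets into positive ones. *)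
Lemma basin_iff F a x : entire F ->
  basin F a x <-> (attracting F a /\ converges F a x) \/
                  (repelling F a /\ converges (reverse F) a x).
Proof.
  intros HF.
  assert (E : repelling F a -> (forall y, w_minus F x y <-> y = a) <-> converges (reverse F) a x).
  { intros Hr. rewrite <- (omega_limit_iff (reverse F) a x (reverse_entire F HF)
      (attracting_reverse F a Hr)).
    assert (W : forall y, w_minus F x y <-> w_plus (reverse F) x y).
    { intros y. split; [now apply w_minus_reverse|]. apply w_plus_reverse.
      intros z. unfold reverse. ring. }
    split; intros H y; rewrite <- (H y); [symmetry|]; apply W. }
  unfold basin. split; (intros [[H1 H2]|[H1 H2]]; [left|right]; split; auto).
  - now apply omega_limit_iff.
  - now apply E.
  - now apply omega_limit_iff.
  - now apply E.
Qed.

Definition local_attractor (F : C -> C) (a : C) (r : R) : Prop :=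
  0 < r /\ forall y, Cmod (y - a) < r -> converges F a y.

Lemma attracting_local F a : entire F -> attracting F a -> exists r, local_attractor F a r.
Proof.
  intros HF H. apply locally_Cmod in H as (r & Hr & H). exists r. split; [exact Hr|].
  intros y Hy. apply tends_converges; auto.
Qed.

(** At a regular point the orbit is bounded, hence stable: nearby orbits enter the attracted
disk. *)
Lemma converges_open F a r x : entire F -> local_attractor F a r -> converges F a x ->
  exists d, 0 < d /\ forall y, Cmod (y - x) < d -> converges F a y.
Proof.
  intros HF [Hr Ha] (e & phi & He & Hphi & P0 & Hlim).
  assert (HL := entire_lipschitz F HF).
  destruct (Ceq_dec (F x) (RtoC 0)) as [Z|Z].
  - (* an equilibrium can only tend to [a] by being [a] *)
    enough (x = a) as -> by (exists r; auto).
    assert (E : forall t, 0 <= t -> phi t = x).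
    { intros t Ht. apply (solution_unique F (- e) p_infty (- e) p_infty phi (fun _ => x) 0 t); auto.
      - apply solution_rder. intros s _. rewrite Z. apply der_const.
      - split; simpl; [lra | exact I].
      - split; simpl; [lra | exact I].
      - split; simpl; [lra | exact I].
      - split; simpl; [lra | exact I]. }
    apply Cmod_minus_0. apply le_epsilon. intros d Hd. destruct (Hlim d Hd) as [T HT].
    specialize (HT (Rmax T 0) (Rmax_l _ _)). rewrite E in HT by apply Rmax_r. lra.
  - destruct (Hlim (r / 2)) as [T0 HT0]; [lra|]. set (T := Rmax T0 0).
    pose proof (Rmax_l T0 0 : T0 <= T). pose proof (Rmax_r T0 0 : 0 <= T).
    destruct (rcont_bounded phi (- (e / 2)) T) as [M HM]; [lra| |].
    { intros t Ht. eapply der_cont. rewrite solution_rder in Hphi. apply Hphi.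
      split; simpl; [lra | exact I]. }
    destruct (bounded_stability F (Rmax M (Cmod a + r / 2)) (- (e / 2)) p_infty phi (r / 2))
      as (d & Hd & Hstab); auto; try lra.
    + apply (solution_restrict F (- e) p_infty); auto; simpl; [lra | exact I].
    + intros t [B _]. simpl in B. destruct (Rle_dec t T) as [Ht|Ht].
      * eapply Rle_trans; [|apply Rmax_l]. apply HM. lra.
      * eapply Rle_trans; [|apply Rmax_r]. specialize (HT0 t ltac:(lra)).
        pose proof (Cmod_le_minus (phi t) a). lra.
    + split; simpl; [lra | exact I].
    + rewrite P0. exact Z.
    + exists d. split; [exact Hd|]. rewrite P0 in Hstab. intros y Hy.
      destruct (Hstab y Hy) as (eta & <- & He1 & He2).
      apply (converges_invariant F a (- (e / 2)) p_infty eta T 0); auto.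
      * split; simpl; [lra | exact I].
      * split; simpl; [lra | exact I].
      * apply Ha. eapply Rle_lt_trans; [apply (Cmod_tri3 _ (phi T))|].
        specialize (He2 T ltac:(split; simpl; [lra | exact I])).
        specialize (HT0 T ltac:(lra)). lra.
Qed.

(** Some orbit tending to [a] starts so near [gam 0] that it stays within [r / 2] of [gam]. *)
Lemma converges_of_limit F a r e gam M : entire F -> local_attractor F a r -> 0 < e ->
  solution F (- e) p_infty gam -> (forall t, - e < t -> Cmod (gam t) <= M) ->
  F (gam 0) <> RtoC 0 ->
  (forall d, 0 < d -> exists y, Cmod (y - gam 0) < d /\ converges F a y) ->
  converges F a (gam 0).
Proof.
  intros HF [Hr Ha] He Hg HM Hn Hcl. assert (HL := entire_lipschitz F HF).
  assert (B : forall t, 0 <= t -> between (- e) p_infty t).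
  { intros t Ht. split; simpl; [lra | exact I]. }
  destruct (bounded_stability F M (- e) p_infty gam (r / 2)) as (d & Hd & Hstab); auto; try lra.
  { intros t [T _]. auto. }
  { apply B. lra. }
  destruct (Hcl d Hd) as (y & Hy & e' & phi & He' & Hphi & P0 & Hlim).
  destruct (Hstab y Hy) as (eta & E0 & He1 & He2).
  destruct (Hlim (r / 2)) as [T0 HT0]; [lra|]. set (T := Rmax T0 0).
  pose proof (Rmax_l T0 0 : T0 <= T). pose proof (Rmax_r T0 0 : 0 <= T).
  apply (converges_invariant F a (- e) p_infty gam T 0); auto; [apply B; lra|].
  assert (E : eta T = phi T).
  { apply (solution_unique F (- e) p_infty (- e') p_infty eta phi 0 T); auto.
    - apply B. lra.
    - split; simpl; [lra | exact I].
    - split; simpl; [lra | exact I].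
    - congruence. }
  apply Ha. eapply Rle_lt_trans; [apply (Cmod_tri3 _ (eta T))|].
  specialize (He2 T (B T ltac:(lra))). specialize (HT0 T ltac:(lra)).
  rewrite (Cmod_minus_sym (gam T)). rewrite <- E in HT0. lra.
Qed.

(** Pull a point [s] of the larger disk back to [rho s = q * s] in the smaller one, and move on from
[G (rho s)] for the remaining time [s - rho s].  Uniqueness shows that near [s0] the base point
[rho s] may be replaced by the fixed point [rho s0], so the result is holomorphic. *)
Lemma cflow_extend (F : C -> C) (B : C -> Prop) (w : C -> C -> C) (de R0 : R) (x : C) (G : C -> C) :
  locally_Lipschitz F ->
  (forall y, B y -> w y (RtoC 0) = y /\ cflow F de (w y) /\ forall s, Cmod s < de -> B (w y s)) ->
  0 < de -> de / 2 <= R0 ->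
  G (RtoC 0) = x -> cflow F R0 G -> (forall s, Cmod s < R0 -> B (G s)) ->
  exists G', G' (RtoC 0) = x /\ cflow F (R0 + de / 2) G' /\
    forall s, Cmod s < R0 + de / 2 -> B (G' s).
Proof.
  intros HL Hw Hde HR G0 HG HB.
  (* [q] is chosen so that [rho] maps into the disk of radius [R0 - de / 4], which leaves a
     remaining time of modulus at most [3 / 4 * de] *)
  set (R1 := R0 + de / 2). set (q := (R0 - de / 4) / R1).
  assert (Hq : 0 < q < 1).
  { unfold q, R1. split; [apply Rdiv_lt_0_compat; lra|].
    apply Rmult_lt_reg_r with (R0 + de / 2); [lra|]. unfold Rdiv.
    rewrite Rmult_assoc, Rinv_l by lra. lra. }
  assert (Eq : q * R1 = R0 - de / 4) by (unfold q, R1; field; lra).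
  set (rho := fun s => (RtoC q * s)%C).
  assert (Hrho : forall s, Cmod s < R1 -> Cmod (rho s) < R0).
  { intros s Hs. unfold rho. rewrite Cmod_mult, Cmod_R, Rabs_pos_eq by lra.
    assert (q * Cmod s < q * R1) by (apply Rmult_lt_compat_l; lra). lra. }
  assert (Hrest : forall s, Cmod s < R1 -> Cmod (s - rho s) < de).
  { intros s Hs. replace (s - rho s)%C with (RtoC (1 - q) * s)%C
      by (unfold rho; rewrite RtoC_minus; ring).
    rewrite Cmod_mult, Cmod_R, Rabs_pos_eq by lra.
    assert ((1 - q) * Cmod s < (1 - q) * R1) by (apply Rmult_lt_compat_l; lra).
    unfold R1 in *. lra. }
  set (branch := fun s z => w (G (rho s)) (z - rho s)%C).
  assert (Hbr : forall s z, Cmod s < R1 -> Cmod (z - rho s) < de ->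
    cder (branch s) z (F (branch s z))).
  { intros s z Hs Hz. destruct (Hw _ (HB _ (Hrho s Hs))) as (_ & w1 & _).
    eapply der_ext; [reflexivity| |
      apply (der_comp _ (fun z => z - rho s)%C (w (G (rho s))))].
    3: { apply der_minus; [apply der_id | apply der_const]. }
    2: { apply w1, Hz. }
    simpl. unfold branch. ring. }
  assert (Hbr0 : forall s, Cmod s < R1 -> branch s (rho s) = G (rho s)).
  { intros s Hs. unfold branch. replace (rho s - rho s)%C with (RtoC 0) by ring.
    apply Hw, HB, Hrho, Hs. }
  assert (agree : forall s s0, Cmod s < R1 -> Cmod s0 < R1 -> Cmod (rho s - rho s0) < de ->
    Cmod (s - rho s0) < de -> branch s s = branch s0 s).
  { intros s s0 Hs Hs0 H1 H2.
    assert (J : branch s0 (rho s) = G (rho s)).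
    { apply (cflow_unique F (fun z => Cmod z < R0 /\ Cmod (z - rho s0) < de)
        (branch s0) G (rho s0) (rho s) HL).
      - intros p r t [P1 P2] [Q1 Q2] Ht. split.
        + apply (gauge_convex Cmod R0 Cmod_gauge p r t); auto.
        + apply (disk_convex (rho s0) de p r t); auto.
      - split; [apply Hrho, Hs0 | rewrite Cmod_minus_diag; exact Hde].
      - split; [apply Hrho, Hs | exact H1].
      - intros z [_ Hz]. apply Hbr; auto.
      - intros z [Hz _]. apply HG, Hz.
      - apply Hbr0, Hs0. }
    apply (cflow_unique F (fun z => Cmod (z - rho s) < de /\ Cmod (z - rho s0) < de)
        (branch s) (branch s0) (rho s) s HL).
    - intros p r t [P1 P2] [Q1 Q2] Ht.
      split; [apply (disk_convex (rho s) de p r t) | apply (disk_convex (rho s0) de p r t)]; auto.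
    - split; [rewrite Cmod_minus_diag; exact Hde | exact H1].
    - split; [apply Hrest, Hs | exact H2].
    - intros z [Hz _]. apply Hbr; auto.
    - intros z [_ Hz]. apply Hbr; auto.
    - rewrite J. apply Hbr0, Hs. }
  exists (fun s => branch s s). split; [|split].
  - assert (E : rho (RtoC 0) = RtoC 0) by (unfold rho; ring).
    unfold branch. rewrite E, G0. replace (RtoC 0 - RtoC 0)%C with (RtoC 0) by ring.
    apply Hw. rewrite <- G0. apply HB. rewrite Cmod_0. lra.
  - intros s0 Hs0.
    set (r := Rmin (R1 - Cmod s0) (de - Cmod (s0 - rho s0))).
    pose proof (Hrest s0 Hs0) as K.
    assert (Hr : 0 < r) by (apply Rmin_glb_lt; fold R1 in Hs0; lra).
    apply (der_ext_loc _ (branch s0) _ _ _ r Hr); [|apply Hbr; auto].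
    intros s Hs. apply Rmin_Rgt_l in Hs as [S1 S2]. symmetry. apply agree; auto.
    + pose proof (Cmod_le_minus s s0). lra.
    + replace (rho s - rho s0)%C with (RtoC q * (s - s0))%C by (unfold rho; ring).
      rewrite Cmod_mult, Cmod_R, Rabs_pos_eq by lra.
      pose proof (Cmod_ge_0 (s - s0)). pose proof (Cmod_ge_0 (s0 - rho s0)). nra.
    + eapply Rle_lt_trans; [apply (Cmod_tri3 _ s0)|]. lra.
  - intros s Hs. apply Hw; [apply HB, Hrho, Hs | apply Hrest, Hs].
Qed.

(** Liouville: on disks of any radius there is a solution with values bounded by [M], so its
derivative [F x] at 0 vanishes by Cauchy's estimate. *)
Lemma no_bounded_cflow_invariant_set (F : C -> C) (B : C -> Prop) (w : C -> C -> C) (de M : R) x :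
  entire F -> 0 < de ->
  (forall y, B y -> w y (RtoC 0) = y /\ cflow F de (w y) /\ forall s, Cmod s < de -> B (w y s)) ->
  (forall y, B y -> Cmod y <= M) -> B x -> F x = RtoC 0.
Proof.
  intros HF Hde Hw HM Bx.
  assert (ext : forall n, exists G, G (RtoC 0) = x /\ cflow F (de + INR n * (de / 2)) G /\
    forall s, Cmod s < de + INR n * (de / 2) -> B (G s)).
  { induction n as [|n (G & G0 & G1 & G2)].
    - exists (w x). destruct (Hw x Bx) as (w0 & w1 & w2). simpl INR.
      rewrite Rmult_0_l, Rplus_0_r. auto.
    - rewrite S_INR. replace (de + (INR n + 1) * (de / 2)) with (de + INR n * (de / 2) + de / 2)
        by ring.
      apply (cflow_extend F B w de _ x G (entire_lipschitz F HF)); auto.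
      pose proof (pos_INR n). nra. }
  assert (M0 : 0 <= M) by (eapply Rle_trans; [apply Cmod_ge_0 | apply (HM x Bx)]).
  apply Cmod_eq_0. apply Rle_antisym; [|apply Cmod_ge_0]. apply le_epsilon. intros e He.
  destruct (INR_archimed (de / 2) (2 * M / e)) as [n Hn]; [lra|].
  destruct (ext n) as (G & G0 & G1 & G2).
  set (r := de / 2 + INR n * (de / 2)). pose proof (pos_INR n) as Hn0.
  assert (Hr : 0 < r) by (unfold r; nra).
  rewrite Rplus_0_l. apply Rle_trans with (2 * M / r).
  - rewrite <- G0. apply (cauchy_estimate G (RtoC 0) _ (de + INR n * (de / 2)) r); auto.
    + unfold r. lra.
    + intros z Hz. eexists. apply G1. now replace (z - RtoC 0)%C with z in Hz by ring.
    + intros z Hz. replace (z - RtoC 0)%C with z in Hz by ring.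
      eapply Rle_trans; [apply Cmod_minus_le|].
      assert (Cmod (G z) <= M) by (apply HM, G2; unfold r in Hz; lra).
      assert (Cmod (G (RtoC 0)) <= M) by (rewrite G0; auto). lra.
    + apply G1. rewrite Cmod_0. nra.
  - apply Rmult_le_reg_r with r; [exact Hr|]. unfold Rdiv. rewrite Rmult_assoc, Rinv_l by lra.
    assert (2 * M / e < r) by (unfold r; lra).
    apply Rmult_lt_compat_l with (r := e) in H; [|exact He].
    replace (e * (2 * M / e)) with (2 * M) in H by (field; lra). lra.
Qed.

(** If the attracted set were bounded, a small complex time step would keep orbits so close that the
moved ones also tend to [a]; the set would be invariant under complex time. *)
Lemma converges_unbounded F a r : entire F -> simple_zero F a -> local_attractor F a r ->
  unbounded (converges F a).
Proof.
  intros HF [Fa Fa'] [Hr Ha] [M HM]. assert (HL := entire_lipschitz F HF).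
  (* near the simple zero [a], [F x] is close to [F'(a) (x - a)] *)
  assert (Hx : exists x, Cmod (x - a) < r /\ F x <> RtoC 0).
  { apply Cmod_gt_0 in Fa'. set (l := C_derive F a) in *.
    destruct (entire_cder F HF a (Cmod l / 2)) as [d [Hd H]]; [lra|]. fold l in H.
    set (h := Rmin r d / 2).
    assert (Hm : 0 < Rmin r d) by (apply Rmin_glb_lt; lra).
    pose proof (Rmin_l r d). pose proof (Rmin_r r d).
    exists (a + RtoC h)%C.
    assert (E : Cmod (a + RtoC h - a) = h).
    { replace (a + RtoC h - a)%C with (RtoC h) by ring. rewrite Cmod_R. apply Rabs_pos_eq.
      unfold h. lra. }
    split; [rewrite E; unfold h; lra|]. intros Z.
    specialize (H (a + RtoC h)%C). rewrite E, Z, Fa in H.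
    replace (RtoC 0 - RtoC 0 - l * (a + RtoC h - a))%C with (- (l * (a + RtoC h - a)))%C in H by ring.
    rewrite Cmod_opp, Cmod_mult, E in H. unfold h in *. specialize (H ltac:(lra)). nra. }
  destruct Hx as (x & Hx & Fx).
  destruct (local_flow F M HF) as (de & A & w & Hde & HA & Hw).
  set (de' := Rmin de (r / (2 * A))).
  assert (Hde' : 0 < de') by (apply Rmin_glb_lt; [lra | apply Rdiv_lt_0_compat; lra]).
  apply Fx. apply (no_bounded_cflow_invariant_set F (converges F a) w de' M); auto.
  intros y Hy. destruct (Hw y (HM y Hy)) as (w0 & w1 & w2).
  split; [exact w0|]. split.
  - intros s Hs. apply w1. eapply Rlt_le_trans; [apply Hs | apply Rmin_l].
  - intros s Hs. apply Rmin_Rgt_l in Hs as [S1 S2].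
    destruct Hy as (e & phi & He & Hphi & P0 & Hlim).
    assert (B : forall t, 0 <= t -> between (- e) p_infty t).
    { intros t Ht. split; simpl; [lra | exact I]. }
    assert (HM' : forall t, between (- e) p_infty t -> Cmod (phi t) <= M).
    { intros t Ht. apply HM. apply (converges_invariant F a (- e) p_infty phi 0 t); auto.
      - apply B. lra.
      - exists e, phi. auto. }
    destruct (Hlim (r / 2)) as [T0 HT0]; [lra|]. set (T := Rmax T0 0).
    pose proof (Rmax_l T0 0 : T0 <= T). pose proof (Rmax_r T0 0 : 0 <= T).
    rewrite <- P0.
    apply (converges_invariant F a (- e) p_infty (fun t => w (phi t) s) T 0); auto.
    + apply (flow_commutes F M de); auto.
      intros z Hz. destruct (Hw z Hz) as (a1 & a2 & _). auto.
    + apply B. lra.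
    + apply Ha. eapply Rle_lt_trans; [apply (Cmod_tri3 _ (phi T))|].
      destruct (Hw _ (HM' T (B T ltac:(lra)))) as (_ & _ & a3). specialize (a3 s S1).
      specialize (HT0 T ltac:(lra)).
      apply Rmult_gt_compat_l with (r := A) in S2; [|lra].
      replace (A * (r / (2 * A))) with (r / 2) in S2 by (field; lra). lra.
Qed.

Lemma boundary_iff S z : boundary S z <->
  forall r, 0 < r -> (exists y, Cmod (y - z) < r /\ S y) /\ (exists y, Cmod (y - z) < r /\ ~ S y).
Proof.
  split.
  - intros H r Hr. apply (H (fun y => Cmod (y - z) < r)).
    + intros y Hy. apply locally_Cmod. apply (disk_open z r y Hy).
    + rewrite Cmod_minus_diag. exact Hr.
  - intros H U HU Uz. apply HU in Uz. apply locally_Cmod in Uz as (r & Hr & HrU).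
    destruct (H r Hr) as [(y & Y1 & Y2) (y' & Y1' & Y2')]. split; eauto.
Qed.

Lemma basin_invariant F a al be phi t0 t1 : entire F -> solution F al be phi ->
  between al be t0 -> between al be t1 -> basin F a (phi t0) -> basin F a (phi t1).
Proof.
  intros HF Hphi B0 B1. rewrite !basin_iff by exact HF.
  intros [[H1 H2]|[H1 H2]]; [left|right]; split; auto.
  - apply (converges_invariant F a al be phi t0 t1); auto. apply entire_lipschitz, HF.
  - pose proof (converges_invariant (reverse F) a (Rbar_opp be) (Rbar_opp al)
      (fun t => phi (- t)) (- t0) (- t1)) as K. cbv beta in K. rewrite !Ropp_involutive in K.
    apply K; auto using between_opp.
    + apply entire_lipschitz, reverse_entire, HF.
    + now apply (solution_reverse F).
Qed.

(** On a compact time interval every solution is bounded, so stability gives continuous dependence on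
the initial value, and points inside and outside the basin near [z] are carried near [y]. *)
Lemma basin_boundary_invariant F a z y : entire F -> F z <> RtoC 0 ->
  boundary (basin F a) z -> orbit F z y -> boundary (basin F a) y.
Proof.
  intros HF Fz Hz (al & be & phi & (B0 & P0 & Hs & _) & t1 & B1 & <-).
  rewrite boundary_iff in *. intros r Hr.
  destruct (Rbar_dense al (Rmin 0 t1)) as [m [M1 M2]].
  { unfold Rmin. destruct Rle_dec; [apply B0 | apply B1]. }
  destruct (Rbar_dense (Rmax 0 t1) be) as [n [N1 N2]].
  { unfold Rmax. destruct Rle_dec; [apply B1 | apply B0]. }
  simpl in M2, N1.
  pose proof (Rmin_l 0 t1). pose proof (Rmin_r 0 t1).
  pose proof (Rmax_l 0 t1). pose proof (Rmax_r 0 t1).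
  destruct (rcont_bounded phi m n) as [M HM]; [lra| |].
  { intros t Ht. eapply der_cont. rewrite solution_rder in Hs. apply Hs. split.
    - eapply Rbar_lt_le_trans; [apply M1|]. simpl. lra.
    - eapply Rbar_le_lt_trans; [|apply N2]. simpl. lra. }
  assert (Hs' : solution F m n phi).
  { apply (solution_restrict F al be); auto; apply Rbar_lt_le; assumption. }
  assert (C0 : between m n 0) by (split; simpl; lra).
  assert (C1 : between m n t1) by (split; simpl; lra).
  rewrite <- P0 in Hz.
  destruct (bounded_stability F M m n phi (r / 2) HF Hs') as (d & Hd & Hstab); auto; try lra.
  { intros t [T1 T2]. simpl in T1, T2. apply HM. lra. }
  { rewrite P0. exact Fz. }
  destruct (Hz d Hd) as [(u & U1 & U2) (v & V1 & V2)]. split.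
  - destruct (Hstab u U1) as (eta & E0 & E1 & E2). exists (eta t1). split.
    + specialize (E2 t1 C1). lra.
    + apply (basin_invariant F a m n eta 0 t1); auto. congruence.
  - destruct (Hstab v V1) as (eta & E0 & E1 & E2). exists (eta t1). split.
    + specialize (E2 t1 C1). lra.
    + intros Hb. apply V2. rewrite <- E0. now apply (basin_invariant F a m n eta t1 0).
Qed.

(** A regular point with bounded orbit cannot lie on the boundary of the attracted set. *)
Lemma converges_of_bounded_orbit F a al be phi z M : entire F -> attracting F a ->
  maximal_solution F z al be phi -> (forall t, between al be t -> Cmod (phi t) <= M) ->
  F z <> RtoC 0 ->
  (forall d, 0 < d -> exists y, Cmod (y - z) < d /\ converges F a y) ->
  exists d, 0 < d /\ forall y, Cmod (y - z) < d -> converges F a y.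
Proof.
  intros HF Ha Hm HM Fz Hcl. destruct (attracting_local F a HF Ha) as [r Hr].
  pose proof Hm as (B0 & P0 & Hs & _).
  assert (be = p_infty) as ->.
  { apply (bounded_maximal_global F z al be phi M 0); auto. }
  destruct (between_open _ _ _ B0) as [e [He He']].
  apply (converges_open F a r z HF Hr). rewrite <- P0 in *.
  assert (Ble : Rbar_le al (- (e / 2))).
  { apply Rbar_lt_le. apply (He' (- (e / 2))). rewrite Rminus_0_r, Rabs_Ropp, Rabs_pos_eq; lra. }
  apply (converges_of_limit F a r (e / 2) phi M); auto; [lra| |].
  - apply (solution_restrict F al p_infty); auto. apply Rbar_le_refl.
  - intros t Ht. apply HM. split; [|exact I]. eapply Rbar_le_lt_trans; [apply Ble | exact Ht].
Qed.

(** Basin points accumulate at [z], so points of at least one of the two attracted sets do; a bounded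
orbit would put a neighbourhood of [z] into that set. *)
Lemma basin_boundary_orbit_unbounded F a z : entire F -> F z <> RtoC 0 ->
  boundary (basin F a) z -> unbounded (orbit F z).
Proof.
  intros HF Fz Hz [M HM]. rewrite boundary_iff in Hz.
  destruct (maximal_exists F z HF) as (al & be & phi & Hm).
  assert (HM' : forall t, between al be t -> Cmod (phi t) <= M).
  { intros t Ht. apply HM. exists al, be, phi. eauto. }
  assert (Hno : forall d, 0 < d -> ~ forall y, Cmod (y - z) < d -> basin F a y).
  { intros d Hd H. destruct (Hz d Hd) as [_ (y & Y1 & Y2)]. auto. }
  assert (N1 : exists d, 0 < d /\ forall y, Cmod (y - z) < d -> ~ (attracting F a /\ converges F a y)).
  { apply NNPP. intros Hn.
    assert (Hcl : forall d, 0 < d -> exists y, Cmod (y - z) < d /\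
       attracting F a /\ converges F a y).
    { intros d Hd. apply NNPP. intros Hn'. apply Hn. exists d. split; [exact Hd|].
      intros y Hy Hc. apply Hn'. eauto. }
    assert (Ha : attracting F a) by (destruct (Hcl 1 Rlt_0_1) as (y & _ & H & _); exact H).
    destruct (converges_of_bounded_orbit F a al be phi z M) as (d & Hd & H); auto.
    - intros d Hd. destruct (Hcl d Hd) as (y & Y1 & _ & Y2). eauto.
    - apply (Hno d Hd). intros y Hy. apply basin_iff; auto. }
  assert (N2 : exists d, 0 < d /\ forall y, Cmod (y - z) < d ->
    ~ (repelling F a /\ converges (reverse F) a y)).
  { apply NNPP. intros Hn.
    assert (Hcl : forall d, 0 < d -> exists y, Cmod (y - z) < d /\
       repelling F a /\ converges (reverse F) a y).
    { intros d Hd. apply NNPP. intros Hn'. apply Hn. exists d. split; [exact Hd|].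
      intros y Hy Hc. apply Hn'. eauto. }
    assert (Ha : repelling F a) by (destruct (Hcl 1 Rlt_0_1) as (y & _ & H & _); exact H).
    destruct (converges_of_bounded_orbit (reverse F) a (Rbar_opp be) (Rbar_opp al)
      (fun t => phi (- t)) z M) as (d & Hd & H).
    - apply reverse_entire, HF.
    - apply attracting_reverse, Ha.
    - now apply (maximal_reverse F).
    - intros t Ht. apply HM', between_opp_inv, Ht.
    - unfold reverse. intros E. apply Fz. rewrite <- (Copp_0), <- E. ring.
    - intros d Hd. destruct (Hcl d Hd) as (y & Y1 & _ & Y2). eauto.
    - apply (Hno d Hd). intros y Hy. apply basin_iff; auto. }
  destruct N1 as (d1 & D1 & N1). destruct N2 as (d2 & D2 & N2).
  destruct (Hz (Rmin d1 d2) ltac:(apply Rmin_glb_lt; lra)) as [(y & Y1 & Y2) _].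
  apply Rmin_Rgt_l in Y1 as [Y1 Y1']. apply (basin_iff F a y HF) in Y2 as [H|H].
  - exact (N1 y Y1 H).
  - exact (N2 y Y1' H).
Qed.

Lemma reverse_simple_zero F a : entire F -> simple_zero F a -> simple_zero (reverse F) a.
Proof.
  intros HF [H1 H2]. split; [unfold reverse; rewrite H1; apply Copp_0|].
  assert (E : C_derive (reverse F) a = (- C_derive F a)%C).
  { apply is_C_derive_unique. apply (is_derive_opp (V := C_NormedModule) F).
    apply C_derive_correct; [exact (RtoC 0) | apply HF]. }
  rewrite E. intros Z. apply H2. replace (C_derive F a) with (- - C_derive F a)%C by ring.
  rewrite Z. apply Copp_0.
Qed.

Lemma unbounded_mono (S T : C -> Prop) : (forall z, S z -> T z) -> unbounded S -> unbounded T.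
Proof. intros H HS [M HM]. apply HS. exists M. auto. Qed.

Lemma basin_unbounded F a : entire F -> node_or_focus F a -> unbounded (basin F a).
Proof.
  intros HF [Hz [Ha|Hr]].
  - destruct (attracting_local F a HF Ha) as [r Hr].
    apply (unbounded_mono (converges F a)); [|apply (converges_unbounded F a r); auto].
    intros z Hc. apply basin_iff; auto.
  - destruct (attracting_local (reverse F) a (reverse_entire F HF) (attracting_reverse F a Hr))
      as [r Hr'].
    apply (unbounded_mono (converges (reverse F) a)).
    + intros z Hc. apply basin_iff; auto.
    + apply (converges_unbounded (reverse F) a r); auto using reverse_entire, reverse_simple_zero.
Qed.

Theorem theorem4p5 (F : C -> C) (a : C) :
  entire F ->
  (exists z : C, F z <> RtoC 0) ->
  node_or_focus F a ->
  ((forall z : C, ~ boundary (basin F a) z) \/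
   (forall z : C, boundary (basin F a) z ->
      equilibrium F z \/
      (unbounded (orbit F z) /\
       forall y : C, orbit F z y -> boundary (basin F a) y))) /\
  unbounded (basin F a).
Proof.
  intros HF _ Ha. split; [right | now apply basin_unbounded].
  intros z Hz. destruct (Ceq_dec (F z) (RtoC 0)) as [Z|Z]; [left; exact Z|right].
  split; [now apply (basin_boundary_orbit_unbounded F a)|].
  intros y. now apply basin_boundary_invariant.
Qed.
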